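(* Let $\mathfrak A$ be a $C^*$-algebra and let $\sigma,\tau:\mathfrak A\to\mathfrak A$ be two $*$-homomorphisms with $\ker(\sigma)=\ker(\tau)$. Then $\mathfrak A$ is $(\sigma,\tau)$-amenable if and only if $\sigma(\mathfrak A)$ is amenable. Likewise, $\mathfrak A$ is $(\sigma,\tau)$-contractible if and only if $\sigma(\mathfrak A)$ is contractible.
   Context: Let $\mathcal A$ be a (complex) Banach algebra and $\sigma,\tau:\mathcal A\to\mathcal A$ linear maps whose images are subalgebras of $\mathcal A$. A $(\tau(\mathcal A),\sigma(\mathcal A))$-bimodule is a vector space with a left $\tau(\mathcal A)$-module action and a right $\sigma(\mathcal A)$-module action that commute with each other; it is a Banach bimodule if it is a Banach space and the two actions are bounded bilinear maps. A linear map $D:\mathcal A\to\mathcal X$ into a $(\tau(\mathcal A),\sigma(\mathcal A))$-bimodule $\mathcal X$ is a $(\sigma,\tau)$-derivation if $D(ab)=D(a)\cdot\sigma(b)+\tau(a)\cdot D(b)$ for all $a,b\in\mathcal A$. A $(\sigma,\tau)$-derivation $D$ is $(\sigma,\tau)$-inner if there is $x\in\mathcal X$ such that either $D(a)=x\cdot\sigma(a)-\tau(a)\cdot x$ for all $a\in\mathcal A$, or $D(a)=x\cdot\sigma(a)+\tau(a)\cdot x$ for all $a\in\mathcal A$. A dual Banach $(\tau(\mathcal A),\sigma(\mathcal A))$-bimodule is a Banach $(\tau(\mathcal A),\sigma(\mathcal A))$-bimodule of the form $\mathcal Y^*$, where $\mathcal Y$ is a Banach space carrying commuting bounded right $\tau(\mathcal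 A)$- and left $\sigma(\mathcal A)$-module actions, with actions on $\mathcal Y^*$ given by $(b\cdot f)(y)=f(yb)$ for $b\in\tau(\mathcal A)$ and $(f\cdot b)(y)=f(by)$ for $b\in\sigma(\mathcal A)$ ($f\in\mathcal Y^*$, $y\in\mathcal Y$). $\mathcal A$ is $(\sigma,\tau)$-amenable if every continuous $(\sigma,\tau)$-derivation from $\mathcal A$ into any dual Banach $(\tau(\mathcal A),\sigma(\mathcal A))$-bimodule is $(\sigma,\tau)$-inner; it is $(\sigma,\tau)$-contractible if every continuous $(\sigma,\tau)$-derivation from $\mathcal A$ into any Banach $(\tau(\mathcal A),\sigma(\mathcal A))$-bimodule is $(\sigma,\tau)$-inner. Amenable and contractible have the usual meaning: every continuous derivation from the Banach algebra into any dual Banach bimodule (respectively, any Banach bimodule) over it is inner, i.e. of the form $a\mapsto x\cdot a-a\cdot x$. *)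

(* Defs.v *)
From HB Require Import structures.
From mathcomp Require Import all_boot all_order all_algebra.
From mathcomp Require Import all_classical all_reals all_analysis.
From mathcomp Require Export complex.
From mathcomp Require Import ring.

Set Implicit Arguments.
Unset Strict Implicit.
Unset Printing Implicit Defensive.

Import Order.TTheory GRing.Theory Num.Theory.
Import numFieldNormedType.Exports.

Local Open Scope classical_set_scope.
Local Open Scope ring_scope.

Reserved Notation "a ** b" (at level 40, left associativity).

(* The algebras below need not be unital, hence are not [nzRingType]s. *)
HB.mixin Record NormedModule_isNormedAlgebra (K : numDomainType) A
    & NormedModule K A := {
  amul : A -> A -> A;
  amulA : forall a b c, amul a (amul b c) = amul (amul a b) c;
  amul_linearl : forall b, linear (amul ^~ b);
  amul_linearr : forall a, linear (amul a);
  ler_norm_amul : forall a b, `|amul a b| <= `|a| * `|b|;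
}.

#[short(type="normedAlgType")]
HB.structure Definition NormedAlgebra (K : numDomainType) :=
  {A of NormedModule K A & NormedModule_isNormedAlgebra K A}.

Notation "a ** b" := (amul a b) : ring_scope.

#[short(type="banachAlgType")]
HB.structure Definition BanachAlgebra (K : numFieldType) :=
  {A of NormedAlgebra K A & Complete A}.

HB.mixin Record BanachAlgebra_isCstarAlgebra (R : realType) A
    & BanachAlgebra R[i] A := {
  star : A -> A;
  starK : involutive star;
  starD : forall a b, star (a + b) = star a + star b;
  starZ : forall (k : R[i]) a, star (k *: a) = k^* *: star a;
  starM : forall a b, star (a ** b) = star b ** star a;
  norm_star_amul : forall a, `|star a ** a| = `|a| ^+ 2;
}.

#[short(type="cstarAlgType")]
HB.structure Definition CstarAlgebra (R : realType) :=
  {A of BanachAlgebra R[i] A & BanachAlgebra_isCstarAlgebra R A}.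

Definition star_hom (R : realType) (A B : cstarAlgType R)
    (f : {linear A -> B}) : Prop :=
  (forall a b, f (a ** b) = f a ** f b) /\ (forall a, f (star a) = star (f a)).

Section RangeAlgebra.
Variables (K : numFieldType) (A B : normedAlgType K) (f : {linear A -> B}).

Definition range_subalg : Prop := forall a b, exists c, f a ** f b = f c.

Hypothesis fM : range_subalg.

(* The image of [f], as a normed algebra in its own right. The proof argument
   supplies the multiplication. *)
Definition range_pred of range_subalg : {pred B} :=
  [pred b | `[< exists a, f a = b >]].

Record range_alg := RangeAlg {
  range_val : B;
  range_valP : range_val \in range_pred fM
}.

HB.instance Definition _ := [isSub for range_val].
HB.instance Definition _ := [Choice of range_alg by <:].

Let range_submod_closed : submod_closed (range_pred fM).
Proof.
split; first by apply/asboolP; exists 0; rewrite linear0.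
move=> k _ _ /asboolP[a <-] /asboolP[b <-].
by apply/asboolP; exists (k *: a + b); rewrite linearP.
Qed.

HB.instance Definition _ := GRing.SubChoice_isSubLmodule.Build
  K B (range_pred fM) range_alg range_submod_closed.

Let range_norm (x : range_alg) : K := `|val x|.

Let ler_range_normD x y : range_norm (x + y) <= range_norm x + range_norm y.
Proof. by rewrite /range_norm linearD ler_normD. Qed.

Let range_normZ k x : range_norm (k *: x) = `|k| * range_norm x.
Proof. by rewrite /range_norm linearZ/= normrZ. Qed.

Let range_norm0_eq0 x : range_norm x = 0 -> x = 0.
Proof. by move=> /eqP; rewrite normr_eq0 => /eqP x0; apply: val_inj. Qed.

HB.instance Definition _ := @Lmodule_isNormed.Build K range_alg
  range_norm ler_range_normD range_normZ range_norm0_eq0.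

Fact range_amulP (x y : range_alg) : range_val x ** range_val y \in range_pred fM.
Proof.
have /asboolP[a <-] := range_valP x; have /asboolP[b <-] := range_valP y.
by apply/asboolP; have [c ->] := fM a b; exists c.
Qed.

Let range_amul x y : range_alg := RangeAlg (range_amulP x y).

Let range_amulA x y z :
  range_amul x (range_amul y z) = range_amul (range_amul x y) z.
Proof. by apply: val_inj; rewrite /= amulA. Qed.

Let range_amul_linearl y : linear (range_amul ^~ y).
Proof. by move=> k x z; apply: val_inj; rewrite /= amul_linearl. Qed.

Let range_amul_linearr x : linear (range_amul x).
Proof. by move=> k y z; apply: val_inj; rewrite /= amul_linearr. Qed.

Let ler_norm_range_amul x y : `|range_amul x y| <= `|x| * `|y|.
Proof. exact: ler_norm_amul. Qed.

HB.instance Definition _ := NormedModule_isNormedAlgebra.Build K range_alg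
  range_amulA range_amul_linearl range_amul_linearr ler_norm_range_amul.

Fact corange_subproof a : f a \in range_pred fM.
Proof. by apply/asboolP; exists a. Qed.

Definition corange (a : A) : range_alg := RangeAlg (corange_subproof a).

End RangeAlgebra.

Lemma star_hom_range_subalg (R : realType) (A B : cstarAlgType R)
  (f : {linear A -> B}) : star_hom f -> range_subalg f.
Proof. by move=> [fM _] a b; exists (a ** b); rewrite fM. Qed.

Section ComplexAux.
Variable R : realType.
Implicit Types k : R[i].

Lemma ge0_complexE k : 0 <= k -> k = (complex.Re k)%:C%C.
Proof. by case: k => a b; rewrite lecE /= => /andP[/eqP-> _]. Qed.

Lemma norm_Re_le k : (`|complex.Re k|)%:C%C <= `|k|.
Proof.
case: k => a b; rewrite normc_def /= lecR.
by rewrite -sqrtr_sqr ler_wsqrtr// lerDl sqr_ge0.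
Qed.

Lemma norm_Im_le k : (`|complex.Im k|)%:C%C <= `|k|.
Proof.
case: k => a b; rewrite normc_def /= lecR.
by rewrite -sqrtr_sqr ler_wsqrtr// lerDr sqr_ge0.
Qed.

Lemma norm_le_ReIm k :
  `|k| <= (`|complex.Re k| + `|complex.Im k|)%:C%C.
Proof.
case: k => a b; rewrite normc_def /= lecR.
rewrite -[leRHS]ger0_norm ?addr_ge0// -sqrtr_sqr ler_wsqrtr//.
by rewrite sqrrD !real_normK ?num_real// addrAC lerDl mulrn_wge0// mulr_ge0.
Qed.

Lemma complex_complete (F : set_system R[i]^o) :
  ProperFilter F -> cauchy F -> cvg F.
Proof.
move=> FF /cauchy_ballP Fc.
have part (p : R[i] -> R) : (forall x y, p (x - y) = p x - p y) ->
    (forall k, (`|p k|)%:C%C <= `|k|) -> cvg (p @ F).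
  move=> pB ple; apply: R_complete; apply/cauchy_ballP => e e0.
  have e0' : 0 < e%:C%C :> R[i] by rewrite ltcR.
  have [[A B]/= [FA FB] AB] := Fc _ e0'.
  exists (p @` A, p @` B); first by split => /=; [
    apply: filterS FA | apply: filterS FB] => x Ax; exists x.
  move=> [_ _] [/= [x Ax <-] [y By <-]].
  rewrite /ball /= -pB -ltcR; apply: le_lt_trans (ple _) _.
  exact: (AB (x, y)).
have /cvg_ex[a Fa] : cvg ((@complex.Re R : R[i]^o -> R) @ F).
  by apply: part norm_Re_le => -[? ?] [? ?].
have /cvg_ex[b Fb] : cvg ((@complex.Im R : R[i]^o -> R) @ F).
  by apply: part norm_Im_le => -[? ?] [? ?].
apply/cvg_ex; exists (Complex a b); apply/cvgrPdist_lt => e e0.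
have eE := ge0_complexE (ltW e0).
have r0 : 0 < complex.Re e / 2 by rewrite divr_gt0// -ltcR -eE.
move/cvgrPdist_lt/(_ _ r0): Fa; move/cvgrPdist_lt/(_ _ r0): Fb.
apply: filterS2 => -[c d] /= bd ac.
apply: le_lt_trans (norm_le_ReIm _) _; rewrite eE ltcR /=.
by rewrite (splitr (complex.Re e)) ltrD.
Qed.

Lemma ler_normM (x M r : R[i]) :
  0 <= x -> 0 <= r -> x <= M * r -> x <= `|M| * r.
Proof.
move=> x0 r0 xMr; rewrite -(ger0_norm r0) -normrM ger0_norm//.
exact: le_trans xMr.
Qed.

End ComplexAux.

Section DualSpace.
Variables (R : realType) (Y : normedModType R[i]).

Definition dual_pred : {pred Y -> R[i]^o} :=
  [pred f : Y -> R[i]^o | `[< linear f /\ continuous f >]].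

Record dual_space := DualSpace {
  dual_fun :> Y -> R[i]^o;
  dual_funP : dual_fun \in dual_pred
}.

HB.instance Definition _ := [isSub for dual_fun].
HB.instance Definition _ := [Choice of dual_space by <:].

Let dual_submod_closed : submod_closed dual_pred.
Proof.
split.
  by apply/asboolP; split=> [k y z|]; [rewrite scaler0 addr0|exact: cst_continuous].
move=> k f g /asboolP[lf cf] /asboolP[lg cg]; apply/asboolP; split=> [c y z|y].
  rewrite !fctE lf lg !scalerDr !scalerA (mulrC k c).
  by rewrite -!addrA; congr (_ + _); rewrite addrCA.
by apply: cvgD; [apply: cvgZl_tmp; exact: cf|exact: cg].
Qed.

HB.instance Definition _ := GRing.SubChoice_isSubLmodule.Build
  R[i] (Y -> R[i]^o) dual_pred dual_space dual_submod_closed.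

Lemma dual_fun_linear (f : dual_space) : linear f.
Proof. by have /asboolP[] := dual_funP f. Qed.

Lemma dual_fun_continuous (f : dual_space) : continuous f.
Proof. by have /asboolP[] := dual_funP f. Qed.

HB.instance Definition _ (f : dual_space) :=
  GRing.isLinear.Build R[i] Y R[i]^o *:%R (dual_fun f) (@dual_fun_linear f).

Lemma dual_pred_bounded (f : Y -> R[i]^o) (M : R[i]) :
  linear f -> (forall y, `|f y| <= M * `|y|) -> f \in dual_pred.
Proof.
move=> f_linear fM; apply/asboolP; split => //.
pose fl : {linear Y -> R[i]^o} :=
  HB.pack f (GRing.isLinear.Build _ _ _ _ f f_linear).
apply: (proj1 (linear_bounded_continuous fl)); apply/bounded_funP => r; exists (`|M| * r) => y yr.
have := fM y => /(ler_normM (normr_ge0 _) (normr_ge0 _))/le_trans; apply.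
by rewrite ler_wpM2l.
Qed.

(* Norms on a [normedModType R[i]] are (real, nonnegative) elements of [R[i]];
   [complex.Re] reads them in [R], where suprema exist. *)
Definition opnorm (f : Y -> R[i]^o) : R :=
  sup [set complex.Re `|f y| | y in [set y | `|y| <= 1]].

Section OpNorm.
Implicit Types f g : dual_space.

Lemma dual_fun_bounded f :
  exists M : R, forall y, `|f y| <= M%:C%C * `|y|.
Proof.
pose fl : {linear Y -> R[i]^o} := f.
have fc : continuous fl := @dual_fun_continuous f.
have [M M0 fM] := pinfty_ex_gt0
  (proj1 (linear_boundedP fl) (proj2 (linear_bounded_continuous fl) fc)).
exists (complex.Re M) => y.
by rewrite -(ge0_complexE (ltW M0)); exact: fM.
Qed.

Lemma opnorm_has_sup f :
  has_sup [set complex.Re `|f y| | y in [set y | `|y| <= 1]].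
Proof.
split; first by exists (complex.Re `|f 0|), 0 => //=; rewrite normr0.
have [M fM] := dual_fun_bounded f; exists `|M| => _ [y y1 <-].
rewrite -lecR -ge0_complexE//; apply: le_trans (fM y) _.
apply: le_trans (_ : `|M|%:C%C * `|y| <= _).
  by rewrite ler_wpM2r// lecR ler_norm.
by rewrite -[leRHS]mulr1 ler_wpM2l// (lecR 0).
Qed.

Lemma le_opnorm f y : `|f y| <= (opnorm f)%:C%C * `|y|.
Proof.
have [->|y0] := eqVneq y 0; first by rewrite linear0 !normr0 mulr0.
have ny0 : 0 < `|y| by rewrite normr_gt0.
rewrite -ler_pdivrMr// (@ge0_complexE _ (`|f y| / `|y|)) ?divr_ge0// lecR.
apply: (sup_upper_bound (opnorm_has_sup f)); exists (`|y|^-1 *: y).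
  by rewrite /= normrZ normfV normr_id mulVf ?gt_eqF.
by rewrite linearZ normrZ normfV normr_id mulrC.
Qed.

Lemma opnorm_le f (M : R) :
  0 <= M -> (forall y, `|f y| <= M%:C%C * `|y|) -> opnorm f <= M.
Proof.
move=> M0 fM; apply: ge_sup; first by case: (opnorm_has_sup f).
move=> _ [y y1 <-]; rewrite -lecR -ge0_complexE//; apply: le_trans (fM y) _.
by rewrite -[leRHS]mulr1 ler_wpM2l// (lecR 0).
Qed.

Lemma opnorm_ge0 f : 0 <= opnorm f.
Proof.
have : complex.Re `|f 0| <= opnorm f.
  by apply: (sup_upper_bound (opnorm_has_sup f)); exists 0; rewrite //= normr0.
by apply: le_trans; rewrite linear0 normr0.
Qed.

Let dual_norm f : R[i] := (opnorm f)%:C%C.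

Let ler_dual_normD f g : dual_norm (f + g) <= dual_norm f + dual_norm g.
Proof.
rewrite /dual_norm -rmorphD lecR opnorm_le ?addr_ge0 ?opnorm_ge0// => y.
by rewrite rmorphD mulrDl (le_trans (ler_normD _ _))// lerD// le_opnorm.
Qed.

Let dual_normZ_le k f : dual_norm (k *: f) <= `|k| * dual_norm f.
Proof.
have E : `|k| * (opnorm f)%:C%C = (complex.Re `|k| * opnorm f)%:C%C.
  by rewrite {1}(ge0_complexE (normr_ge0 k)) rmorphM.
rewrite /dual_norm E lecR; apply: opnorm_le => [|y].
  apply: mulr_ge0; last exact: opnorm_ge0.
  by rewrite -lecR -(ge0_complexE (normr_ge0 k)); exact: normr_ge0.
rewrite -E.
have -> : (k *: f) y = k *: f y by [].
by rewrite normrZ -mulrA ler_wpM2l// le_opnorm.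
Qed.

Let dual_normZ k f : dual_norm (k *: f) = `|k| * dual_norm f.
Proof.
apply/eqP; rewrite eq_le dual_normZ_le/=.
have [->|k0] := eqVneq k 0.
  by rewrite normr0 mul0r /dual_norm (lecR 0) opnorm_ge0.
have := dual_normZ_le k^-1 (k *: f).
by rewrite scalerA mulVf// scale1r normfV ler_pdivlMl ?normr_gt0.
Qed.

Let dual_norm0_eq0 f : dual_norm f = 0 -> f = 0.
Proof.
move=> f0; apply: val_inj; apply/funext => y; apply/eqP.
by rewrite -normr_le0 -(mul0r `|y|) -f0 le_opnorm.
Qed.

HB.instance Definition _ := @Lmodule_isNormed.Build R[i] dual_space
  dual_norm ler_dual_normD dual_normZ dual_norm0_eq0.

Lemma dual_normE f : `|f| = (opnorm f)%:C%C.
Proof. by []. Qed.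

End OpNorm.

Lemma dual_complete (F : set_system dual_space) :
  ProperFilter F -> cauchy F -> cvg F.
Proof.
move=> FF Fc.
have dualB (f g : dual_space) y : `|f y - g y| <= `|f - g| * `|y|.
  exact: (le_opnorm (f - g) y).
have evc y : cvg ((fun f : dual_space => f y) @ F).
  apply: complex_complete; apply/cauchy_ballP => e e0.
  have y0 : 0 < `|y| + 1 by rewrite ltr_wpDl.
  have /cauchy_ballP/(_ _ (divr_gt0 e0 y0))[[A B]/= [FA FB] AB] := Fc.
  exists ((fun f : dual_space => f y) @` A, (fun f : dual_space => f y) @` B).
    by split => /=; [apply: filterS FA | apply: filterS FB] => f Af; exists f.
  move=> [_ _] [/= [f Af <-] [g Bg <-]]; have := AB (f, g) (conj Af Bg).
  rewrite -!ball_normE /= => fg; apply: le_lt_trans (dualB f g y) _.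
  apply: (@le_lt_trans _ _ (`|f - g| * (`|y| + 1))).
    by rewrite ler_wpM2l// lerDl.
  by rewrite -ltr_pdivlMr.
pose g y : R[i]^o := lim ((fun f : dual_space => f y) @ F).
have gP y : (fun f : dual_space => f y) @ F --> g y by exact: evc.
have g_linear : linear g.
  move=> k y z; apply: cvg_lim; first exact: norm_hausdorff.
  rewrite (_ : (fun f : dual_space => _) =
    (fun f : dual_space => k *: f y + f z)); last first.
    by apply/funext => f; rewrite linearP.
  by apply: cvgD (gP z); apply: cvgZl_tmp (gP y).
have gle e f : F (ball f e) -> forall y, `|f y - g y| <= e * `|y|.
  move=> Ffe y; apply/ler_addgt0Pr => d d0.
  have Fgy : \forall h \near F, `|g y - (h : dual_space) y| < d.
    by move/cvgrPdist_lt: (gP y); apply.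
  have [h [fh gh]] := @filter_ex _ F _ _ (filterI Ffe Fgy).
  rewrite -(subrKA (h y)) (le_trans (ler_normD _ _))// lerD//; last first.
    by rewrite distrC ltW.
  by apply: le_trans (dualB f h y) _; rewrite ler_wpM2r// ltW.
have g_dual : g \in dual_pred.
  have [f Ff] : exists f, F (ball f 1).
    by move/cauchyP: Fc => /(_ _ ltr01).
  apply: (@dual_pred_bounded _ (1 + `|f|) g_linear) => y.
  rewrite -[g y](subrK (f y)) (le_trans (ler_normD _ _))// mulrDl lerD//.
    by rewrite distrC gle.
  exact: (le_opnorm f y).
apply/cvg_ex; exists (DualSpace g_dual); apply/cvgrPdist_le => e e0.
move/cauchy_ballP/(_ _ e0): Fc => [[A B]/= [FA FB] AB].
apply: filterS FA => f Af; rewrite distrC dual_normE (ge0_complexE (ltW e0)) lecR.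
apply: opnorm_le => [|y]; rewrite -?lecR -(ge0_complexE (ltW e0)); first exact: ltW.
apply: gle.
by apply: filterS FB => h Bh; exact: (AB (f, h)).
Qed.

HB.instance Definition _ := Uniform_isComplete.Build dual_space dual_complete.

End DualSpace.

(* A Banach (B1, B2)-bimodule: B1 acts on the left and B2 on the right. *)
Record banach_bimodule (K : numFieldType) (B1 B2 : normedAlgType K)
    (X : completeNormedModType K) := BanachBimodule {
  lact : B1 -> X -> X;
  ract : X -> B2 -> X;
  lact_linearl : forall x, linear (lact ^~ x);
  lact_linearr : forall a, linear (lact a);
  ract_linearl : forall b, linear (ract ^~ b);
  ract_linearr : forall x, linear (ract x);
  lactA : forall a b x, lact (a ** b) x = lact a (lact b x);
  ractA : forall x a b, ract x (a ** b) = ract (ract x a) b;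
  lractA : forall a x b, ract (lact a x) b = lact a (ract x b);
  lact_bounded : exists M : K, forall a x, `|lact a x| <= M * `|a| * `|x|;
  ract_bounded : exists M : K, forall x b, `|ract x b| <= M * `|x| * `|b|
}.

Section DualBimodule.
Variables (R : realType) (B1 B2 : normedAlgType R[i]).
Variables (Y : completeNormedModType R[i]) (M : banach_bimodule B1 B2 Y).
Implicit Types (f : dual_space Y) (y : Y) (a : B1) (b : B2).

Lemma dual_space_eq (f g : dual_space Y) : (forall y, f y = g y) -> f = g.
Proof. by move=> fg; apply: val_inj; apply/funext. Qed.

Lemma dual_lact_bounded : exists C : R[i], forall b f y,
  `|f (ract M y b)| <= C * `|b| * `|f| * `|y|.
Proof.
have [C CM] := ract_bounded M; exists `|C| => b f y.
apply: le_trans (le_opnorm f _) _; rewrite -dual_normE.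
rewrite [leRHS](_ : _ = `|f| * (`|C| * (`|y| * `|b|))); last by ring.
by rewrite ler_wpM2l//; apply: ler_normM; rewrite ?mulr_ge0// mulrA.
Qed.

Lemma dual_ract_bounded : exists C : R[i], forall f a y,
  `|f (lact M a y)| <= C * `|f| * `|a| * `|y|.
Proof.
have [C CM] := lact_bounded M; exists `|C| => f a y.
apply: le_trans (le_opnorm f _) _; rewrite -dual_normE.
rewrite [leRHS](_ : _ = `|f| * (`|C| * (`|a| * `|y|))); last by ring.
by rewrite ler_wpM2l//; apply: ler_normM; rewrite ?mulr_ge0// mulrA.
Qed.

Fact dual_lactP b f : (fun y => f (ract M y b)) \in @dual_pred R Y.
Proof.
have [C CM] := dual_lact_bounded.
apply: (@dual_pred_bounded _ _ _ (C * `|b| * `|f|)) => [k y z|y]; last exact: CM.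
by rewrite ract_linearl dual_fun_linear.
Qed.

Fact dual_ractP f a : (fun y => f (lact M a y)) \in @dual_pred R Y.
Proof.
have [C CM] := dual_ract_bounded.
apply: (@dual_pred_bounded _ _ _ (C * `|f| * `|a|)) => [k y z|y]; last exact: CM.
by rewrite lact_linearr dual_fun_linear.
Qed.

Let dual_lact b f := DualSpace (dual_lactP b f).
Let dual_ract f a := DualSpace (dual_ractP f a).

Lemma dual_norm_le f (C : R[i]) :
  0 <= C -> (forall y, `|f y| <= C * `|y|) -> `|f| <= C.
Proof.
move=> C0 fC; rewrite dual_normE (ge0_complexE C0) lecR; apply: opnorm_le.
  by rewrite -lecR -(ge0_complexE C0).
by move=> y; rewrite -(ge0_complexE C0).
Qed.

(* The bimodule [Y^*] for the actions [(b . f) y = f (y . b)] and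
   [(f . a) y = f (a . y)]. *)
Program Definition dual_bimodule : banach_bimodule B2 B1 (dual_space Y) :=
  @BanachBimodule _ _ _ _ dual_lact dual_ract _ _ _ _ _ _ _ _ _.
Next Obligation.
move=> f k a b; apply: dual_space_eq => y.
by rewrite /= ract_linearr dual_fun_linear.
Qed.
Next Obligation. by move=> b k f g; apply: dual_space_eq. Qed.
Next Obligation. by move=> b k f g; apply: dual_space_eq. Qed.
Next Obligation.
move=> f k a b; apply: dual_space_eq => y.
by rewrite /= lact_linearl dual_fun_linear.
Qed.
Next Obligation.
by move=> a b f; apply: dual_space_eq => y; rewrite /= ractA.
Qed.
Next Obligation.
by move=> f a b; apply: dual_space_eq => y; rewrite /= lactA.
Qed.
Next Obligation.
by move=> b f a; apply: dual_space_eq => y; rewrite /= lractA.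
Qed.
Next Obligation.
have [C CM] := dual_lact_bounded; exists `|C| => b f.
apply: dual_norm_le => [|y]; first by rewrite !mulr_ge0.
rewrite -!mulrA; apply: ler_normM; rewrite ?mulr_ge0// !mulrA; exact: CM.
Qed.
Next Obligation.
have [C CM] := dual_ract_bounded; exists `|C| => f a.
apply: dual_norm_le => [|y]; first by rewrite !mulr_ge0.
rewrite -!mulrA; apply: ler_normM; rewrite ?mulr_ge0// !mulrA; exact: CM.
Qed.

End DualBimodule.

Section UsualAmenability.
Variables (R : realType) (B : normedAlgType R[i]).

Definition is_derivation (X : completeNormedModType R[i])
    (M : banach_bimodule B B X) (D : {linear B -> X}) : Prop :=
  forall a b, D (a ** b) = ract M (D a) b + lact M a (D b).

Definition is_inner (X : completeNormedModType R[i])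
    (M : banach_bimodule B B X) (D : {linear B -> X}) : Prop :=
  exists x, forall a, D a = ract M x a - lact M a x.

(* Completeness of [B] plays no role in these two notions, so [B] is only a
   normed algebra; this lets them apply to [range_alg], whose completeness is
   a theorem (for *-homomorphisms) rather than part of its construction. *)
Definition amenable : Prop :=
  forall (Y : completeNormedModType R[i]) (M : banach_bimodule B B Y)
         (D : {linear B -> dual_space Y}),
    continuous D -> is_derivation (dual_bimodule M) D ->
    is_inner (dual_bimodule M) D.

Definition contractible : Prop :=
  forall (X : completeNormedModType R[i]) (M : banach_bimodule B B X)
         (D : {linear B -> X}),
    continuous D -> is_derivation M D -> is_inner M D.

End UsualAmenability.

Section SigmaTau.
Variables (R : realType) (A : banachAlgType R[i]) (sigma tau : {linear A -> A}).
Variables (hsigma : range_subalg sigma) (htau : range_subalg tau).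
Local Notation sA := (range_alg hsigma).
Local Notation tA := (range_alg htau).

Definition is_st_derivation (X : completeNormedModType R[i])
    (M : banach_bimodule tA sA X) (D : {linear A -> X}) : Prop :=
  forall a b, D (a ** b) =
    ract M (D a) (corange hsigma b) + lact M (corange htau a) (D b).

Definition is_st_inner (X : completeNormedModType R[i])
    (M : banach_bimodule tA sA X) (D : {linear A -> X}) : Prop :=
  exists x,
    (forall a, D a = ract M x (corange hsigma a) - lact M (corange htau a) x) \/
    (forall a, D a = ract M x (corange hsigma a) + lact M (corange htau a) x).

(* The predual [Y] has the opposite sides: [sigma(A)] acts on its left and
   [tau(A)] on its right, so that [Y^*] is a [(tau(A), sigma(A))]-bimodule. *)
Definition st_amenable : Prop :=
  forall (Y : completeNormedModType R[i]) (M : banach_bimodule sA tA Y)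
         (D : {linear A -> dual_space Y}),
    continuous D -> is_st_derivation (dual_bimodule M) D ->
    is_st_inner (dual_bimodule M) D.

Definition st_contractible : Prop :=
  forall (X : completeNormedModType R[i]) (M : banach_bimodule tA sA X)
         (D : {linear A -> X}),
    continuous D -> is_st_derivation M D -> is_st_inner M D.

End SigmaTau.

(* Main.v *)
Require Import Defs.
From HB Require Import structures.
From mathcomp Require Import all_boot all_order all_algebra.
From mathcomp Require Import all_classical all_reals all_analysis.
From mathcomp Require Import complex.
From mathcomp Require Import ring lra.
Import Order.TTheory GRing.Theory Num.Theory.
Import numFieldNormedType.Exports.

Set Implicit Arguments.
Unset Strict Implicit.
Unset Printing Implicit Defensive.

Local Open Scope classical_set_scope.
Local Open Scope ring_scope.

(** The heart of the matter is that a *-homomorphism [f] lifts with a bound: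
    every [f a] is [f a'] with [|a'| <= 64 |f a|].  For [h] self-adjoint and [v]
    a small multiple [h / 2^N], the element [sqrt (1 - v^2) + i v] of the
    unitization is unitary, so its [2^N]-th power [1 + k] is unitary too: [k] is
    bounded by 2 independently of [h], while [f k] agrees with [i (f h)] up to
    second order.  Correcting the error repeatedly gives the lift.  The same
    unitaries show that a [(sigma, tau)]-derivation [D] vanishes on [ker sigma],
    on which it kills products: there [D] is additive along the powers of [1 + k],
    which stay bounded.  So the isomorphism between [sigma(A)] and [tau(A)] is
    bicontinuous and [D] factors continuously through [sigma(A)].

    Conversely, the only trouble is a derivation of the form
    [D b = x b + b x].  Then [a x b = 0] for all [a] and [b], so [b |-> x b] is a
    derivation into the submodule [W] annihilated by the left action, where the
    left action vanishes and both forms of innerness say [x b = w b] with [w] in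
    [W].  Hence [D] is the inner derivation given by [2 w - x]. *)

(** * Real-valued norms and geometric convergence *)

Section RealNorm.
Variable R : realType.
Implicit Types V W : normedModType R[i].

(* [`|x|] lives in [R[i]], whose order is partial; the real-valued norm makes
   the order total and [lra] applicable. *)
Definition rnorm V (x : V) : R := complex.Re `|x|.

Lemma rnormE V (x : V) : `|x| = (rnorm x)%:C%C.
Proof. by rewrite /rnorm -ge0_complexE. Qed.

Lemma rnorm_ge0 V (x : V) : 0 <= rnorm x.
Proof. by rewrite -lecR -rnormE; exact: normr_ge0. Qed.

Lemma rnorm0 V : rnorm (0 : V) = 0.
Proof. by rewrite /rnorm normr0. Qed.

Lemma rnorm_le0 V (x : V) : rnorm x <= 0 -> x = 0.
Proof. by rewrite -lecR -rnormE normr_le0 => /eqP. Qed.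

Lemma rnormD V (x y : V) : rnorm (x + y) <= rnorm x + rnorm y.
Proof. by rewrite -lecR rmorphD /= -!rnormE ler_normD. Qed.

Lemma rnormN V (x : V) : rnorm (- x) = rnorm x.
Proof. by rewrite /rnorm normrN. Qed.

Lemma rnormB V (x y : V) : rnorm (x - y) <= rnorm x + rnorm y.
Proof. by rewrite -(rnormN y) rnormD. Qed.

Lemma rnormBC V (x y : V) : rnorm (x - y) = rnorm (y - x).
Proof. by rewrite /rnorm distrC. Qed.

Lemma rnormZ V (c : R) (x : V) : rnorm (c%:C%C *: x) = `|c| * rnorm x.
Proof.
apply: complexI; rewrite rmorphM /= -!rnormE normrZ; congr (_ * _).
by rewrite normc_def /= expr0n addr0 sqrtr_sqr.
Qed.

Lemma rnormiZ V (x : V) : rnorm ('i%C *: x) = rnorm x.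
Proof. by rewrite /rnorm normrZ normc_def /= expr0n expr1n add0r sqrtr1 mul1r. Qed.

Lemma rnorm_amul (A : normedAlgType R[i]) (a b : A) :
  rnorm (a ** b) <= rnorm a * rnorm b.
Proof. by rewrite -lecR rmorphM /= -!rnormE ler_norm_amul. Qed.

Lemma rbounded_continuous V W (f : {linear V -> W}) (M : R) :
  (forall x, rnorm (f x) <= M * rnorm x) -> continuous f.
Proof.
move=> fM; apply: (proj1 (linear_bounded_continuous f)).
apply/bounded_funP => r; exists (`|M|%:C%C * r) => x xr.
rewrite rnormE; apply: (@le_trans _ _ (`|M|%:C%C * `|x|)).
  rewrite rnormE -rmorphM /= lecR (le_trans (fM x))// ler_wpM2r ?rnorm_ge0//.
  exact: ler_norm.
by rewrite ler_wpM2l// (lecR 0).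
Qed.

Lemma continuous_rbounded V W (f : {linear V -> W}) :
  continuous f -> exists2 M : R, 0 <= M & forall x, rnorm (f x) <= M * rnorm x.
Proof.
move=> fc; have [M M0 fM] := pinfty_ex_gt0
  (proj1 (linear_boundedP f) (proj2 (linear_bounded_continuous f) fc)).
have ME := ge0_complexE (ltW M0).
exists (complex.Re M) => [|x]; first by rewrite -lecR -ME ltW.
by rewrite -lecR rmorphM /= -ME -!rnormE.
Qed.

(** Since [2 ^+ n] outgrows every real, an estimate with error [C / 2 ^+ n] is exact in the limit;
    equalities between limits are obtained this way below. *)
Lemma le0_geometric (x C : R) : (forall n, x <= C / 2 ^+ n) -> x <= 0.
Proof.
move=> xC; rewrite leNgt; apply/negP => x0.
have [n Cn] : exists n, C / x < n%:R.
  by exists (Num.Def.archi_bound `|C / x|); apply: le_lt_trans (ler_norm _) _;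
    exact: archi_boundP.
have : C < x * 2 ^+ n.
  rewrite ltr_pdivrMr// mulrC in Cn; apply: lt_le_trans Cn _.
  rewrite ler_pM2l// -natrX ler_nat; exact/ltnW/ltn_expl.
by rewrite ltNge -ler_pdivlMr ?exprn_gt0// xC.
Qed.

Lemma geometric_cvg (V : completeNormedModType R[i]) (x : nat -> V) (C : R) :
    (forall n, rnorm (x n.+1 - x n) <= C / 2 ^+ n) ->
  exists l, forall n, rnorm (l - x n) <= 2 * C / 2 ^+ n.
Proof.
move=> xC.
have C0 : 0 <= C by have := xC 0%N; rewrite expr0 divr1; apply/le_trans/rnorm_ge0.
(* Keeping the tail [2 * C / 2 ^+ (n + m)] makes the telescoped bound provable by induction on
   [m]. *)
have xnm n m : rnorm (x (n + m)%N - x n) <= 2 * C / 2 ^+ n - 2 * C / 2 ^+ (n + m).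
  elim: m => [|m IH]; first by rewrite addn0 !subrr rnorm0.
  rewrite addnS -[x _ - _](subrKA (x (n + m)%N)).
  apply: le_trans (rnormD _ _) _; apply: le_trans (lerD (xC _) IH) _.
  by rewrite exprS; have : (2 ^+ (n + m) : R) != 0 by []; set e := 2 ^+ _ => e0;
    rewrite [_ / (2 * e)](_ : _ = C / e); [lra | field].
have xnle n m : (n <= m)%N -> rnorm (x m - x n) <= 2 * C / 2 ^+ n.
  move=> /subnKC <-; apply: le_trans (xnm _ _) _.
  by rewrite gerBl mulr_ge0 ?invr_ge0 ?mulr_ge0 ?exprn_ge0.
have : cvgn x.
  apply/cauchy_cvgP/cauchy_exP => e e0.
  have eE := ge0_complexE (ltW e0).
  have e0' : 0 < complex.Re e by rewrite -ltcR -eE.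
  have [n nP] : exists n, 2 * C / 2 ^+ n < complex.Re e.
    apply: contrapT => /forallNP nP; have : complex.Re e <= 0.
      by apply: (@le0_geometric _ (2 * C)) => n; rewrite leNgt; exact/negP/nP.
    by rewrite leNgt e0'.
  exists (x n); exists n => // m /= nm.
  by rewrite -ball_normE /= distrC rnormE eE ltcR (le_lt_trans _ nP)// xnle.
move=> /cvg_ex[l xl]; exists l => n.
apply/ler_addgt0Pr => e e0; have e0' : 0 < e%:C%C :> R[i] by rewrite ltcR.
move/cvgrPdist_lt/(_ _ e0'): xl => -[N _ NP].
have := NP (maxn n N) (leq_maxr _ _); rewrite rnormE ltcR => /ltW le1.
rewrite -(subrKA (x (maxn n N))) addrC; apply: le_trans (rnormD _ _) _.
by rewrite lerD// xnle// leq_maxl.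
Qed.

End RealNorm.

(** * Bilinearity of the product *)

Section AlgebraLaws.
Variables (K : numDomainType) (A : normedAlgType K).
Implicit Types a b c : A.

Lemma amulDl a b c : (a + b) ** c = a ** c + b ** c.
Proof. by have := amul_linearl c 1 a b; rewrite !scale1r. Qed.

Lemma amulDr a b c : a ** (b + c) = a ** b + a ** c.
Proof. by have := amul_linearr a 1 b c; rewrite !scale1r. Qed.

Lemma amul0l a : 0 ** a = 0.
Proof. by apply: (@addrI _ (0 ** a)); rewrite -amulDl !addr0. Qed.

Lemma amul0r a : a ** 0 = 0.
Proof. by apply: (@addrI _ (a ** 0)); rewrite -amulDr !addr0. Qed.

Lemma amulZl k a b : (k *: a) ** b = k *: (a ** b).
Proof. by have := amul_linearl b k a 0; rewrite amul0l !addr0. Qed.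

Lemma amulZr k a b : a ** (k *: b) = k *: (a ** b).
Proof. by have := amul_linearr a k b 0; rewrite amul0r !addr0. Qed.

Lemma amulNl a b : (- a) ** b = - (a ** b).
Proof. by rewrite -scaleN1r amulZl scaleN1r. Qed.

Lemma amulNr a b : a ** (- b) = - (a ** b).
Proof. by rewrite -scaleN1r amulZr scaleN1r. Qed.

Lemma amulBl a b c : (a - b) ** c = a ** c - b ** c.
Proof. by rewrite amulDl amulNl. Qed.

Lemma amulBr a b c : a ** (b - c) = a ** b - a ** c.
Proof. by rewrite amulDr amulNr. Qed.

End AlgebraLaws.

(** * The involution, unitaries and cosines in a C*-algebra *)

Section Cstar.
Variables (R : realType).

Section Star.
Variable A : cstarAlgType R.
Implicit Types a b g k v z : A.

Lemma star0 : star (0 : A) = 0.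
Proof. by apply: (@addrI _ (star 0)); rewrite -starD !addr0. Qed.

Lemma starN a : star (- a) = - star a.
Proof.
by rewrite -scaleN1r starZ rmorphN rmorph1 scaleN1r.
Qed.

Lemma starB a b : star (a - b) = star a - star b.
Proof. by rewrite starD starN. Qed.

Lemma star_iZ a : star ('i%C *: a) = - ('i%C *: star a).
Proof.
rewrite starZ (_ : ('i%C)^* = - 'i%C) ?scaleNr//.
by apply/eqP; rewrite eq_complex /= !oppr0 !eqxx.
Qed.

Lemma star_RZ (c : R) a : star (c%:C%C *: a) = c%:C%C *: star a.
Proof.
rewrite starZ; congr (_ *: _).
by apply/eqP; rewrite eq_complex /= !oppr0 !eqxx.
Qed.

Lemma rnorm_star_amul a : rnorm (star a ** a) = rnorm a ^+ 2.
Proof. by apply: complexI; rewrite rmorphXn /= -!rnormE norm_star_amul. Qed.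

Lemma rnorm_star a : rnorm (star a) = rnorm a.
Proof.
have le b : rnorm b <= rnorm (star b).
  have := rnorm_amul (star b) b; rewrite rnorm_star_amul expr2.
  have := rnorm_ge0 b; rewrite le_eqVlt => /predU1P[<- _|b0].
    exact: rnorm_ge0.
  by rewrite ler_pM2r.
by apply/eqP; rewrite eq_le le -{2}(starK a) le.
Qed.

(* The hypothesis says that [1 + k] is an isometry in the unitization. *)
Lemma rnorm_unitary k z :
  star k + k + star k ** k = 0 -> rnorm (z + k ** z) = rnorm z.
Proof.
move=> k0; apply/eqP; rewrite -(@eqrXn2 _ 2)// ?rnorm_ge0//.
rewrite -!rnorm_star_amul; apply/eqP; congr rnorm.
rewrite starD starM amulDl !amulDr -addrA -[RHS]addr0; congr (_ + _).
rewrite -!amulA -!amulDr -[RHS](amul0r (star z)).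
congr (_ ** _); rewrite -[RHS](amul0l z) -k0 !amulDl amulDr amulA.
by rewrite addrCA addrA.
Qed.

(** At [z = star k] the hypothesis gives [|star k + k ** star k| <= |k|], whence
    [|k|^2 = |k ** star k| <= 2 |k|]. *)
Lemma rnorm_quasi_isometry k :
  (forall z, rnorm (z + k ** z) <= rnorm z) -> rnorm k <= 2.
Proof.
move=> kP; have := kP (star k); have := rnormB (star k + k ** star k) (star k).
have := rnorm_star_amul (star k).
rewrite addrAC subrr add0r starK rnorm_star => ->.
have := rnorm_ge0 k; rewrite le_eqVlt => /predU1P[<-//|k0] le1 le2.
rewrite -(ler_pM2r k0) -expr2; apply: le_trans le1 _.
by rewrite mulrDl mul1r lerD2r.
Qed.

End Star.

(* [g] is [1 - sqrt (1 - v^2)], the limit of [g_{n+1} = (v^2 + g_n^2) / 2]. *)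
Lemma exists_cosine (A : cstarAlgType R) (v : A) :
    star v = v -> rnorm v <= 1 / 2 ->
  exists g, [/\ star g = g, v ** g = g ** v,
                g + g = v ** v + g ** g & rnorm g <= 1 / 4].
Proof.
move=> vv v2.
pose F g := (2^-1)%:C%C *: (v ** v + g ** g).
pose x n := iter n F 0.
have half (a : A) : rnorm ((2^-1)%:C%C *: a) = rnorm a / 2.
  by rewrite rnormZ ger0_norm ?invr_ge0// mulrC.
have vvle : rnorm (v ** v) <= 1 / 4.
  apply: le_trans (rnorm_amul _ _) _.
  have := rnorm_ge0 v; nra.
have xP n : [/\ star (x n) = x n, v ** x n = x n ** v & rnorm (x n) <= 1 / 4].
  elim: n => [|n [IH1 IH2 IH3]].
    split; rewrite ?amul0l ?amul0r ?rnorm0 ?divr_ge0//.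
    exact: star0.
  split.
  - by rewrite /= /F star_RZ starD !starM vv IH1.
  - rewrite /= /F amulZl amulZr; congr (_ *: _).
    by rewrite amulDl amulDr !amulA IH2 -!amulA IH2 !amulA.
  - rewrite /= /F half; have := rnormD (v ** v) (x n ** x n).
    have := rnorm_amul (x n) (x n); have := rnorm_ge0 (x n).
    have : rnorm (x n) * rnorm (x n) <= 1 / 4 * (1 / 4).
      by rewrite ler_pM ?rnorm_ge0.
    lra.
(* As [a ** a - b ** b = a ** (a - b) + (a - b) ** b], the map [F] at least halves distances on the
   ball of radius 1/4. *)
have Fle a b : rnorm a <= 1 / 4 -> rnorm b <= 1 / 4 ->
    rnorm (F a - F b) <= rnorm (a - b) / 2.
  move=> a4 b4; rewrite /F -scalerBr half ler_wpM2r ?invr_ge0//.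
  rewrite opprD addrACA subrr add0r.
  rewrite -(subrKA (a ** b)) -amulBr -amulBl.
  apply: le_trans (rnormD _ _) _.
  have := rnorm_amul a (a - b); have := rnorm_amul (a - b) b.
  have := rnorm_ge0 (a - b); nra.
have xC n : rnorm (x n.+1 - x n) <= 1 / 4 / 2 ^+ n.
  elim: n => [|n IH].
    by rewrite expr0 divr1 subr0; have [] := xP 1%N.
  have [_ _ ?] := xP n; have [_ _ ?] := xP n.+1.
  apply: le_trans (Fle _ _ _ _) _ => //; rewrite exprS invfM mulrCA mulrC.
  by rewrite ler_wpM2l// invr_ge0.
have [g gP] := geometric_cvg xC; exists g.
(* A relation whose defect at [g] is at most 4 times the distance from [g] to each [x n] holds at
   [g]. *)
have lim0 (a : A) : (forall n, rnorm a <= 4 * rnorm (g - x n)) -> a = 0.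
  move=> aP; apply: rnorm_le0; apply: (@le0_geometric _ _ 2) => n.
  apply: le_trans (aP n) _; have := gP n; lra.
have g4 : rnorm g <= 1 / 4.
  rewrite -subr_le0; apply: (@le0_geometric _ _ (1 / 2)) => n.
  have [_ _] := xP n; have := gP n; have := rnormD (g - x n) (x n).
  rewrite subrK; lra.
split => //.
- apply/eqP; rewrite -subr_eq0; apply/eqP/lim0 => n.
  have [xx _ _] := xP n; rewrite -(subrKA (x n)) -{1}xx -starB.
  apply: le_trans (rnormD _ _) _; rewrite rnorm_star (rnormBC (x n)).
  have := rnorm_ge0 (g - x n); lra.
- apply/eqP; rewrite -subr_eq0; apply/eqP/lim0 => n.
  have [_ xx _] := xP n; rewrite -(subrKA (v ** x n)) -amulBr xx -amulBl.
  apply: le_trans (rnormD _ _) _.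
  have := rnorm_amul v (g - x n); have := rnorm_amul (x n - g) v.
  rewrite (rnormBC (x n)); have := rnorm_ge0 (g - x n); nra.
(* [F (x n) = x n.+1] tends both to [g] and to [F g]. *)
- have gF : g = F g.
    apply/eqP; rewrite -subr_eq0; apply/eqP; apply: rnorm_le0.
    apply: (@le0_geometric _ _ 1) => n; rewrite -(subrKA (x n.+1)).
    apply: le_trans (rnormD _ _) _; have [_ _ x4] := xP n.
    have := gP n; have := gP n.+1.
    have : rnorm (x n.+1 - F g) <= rnorm (x n - g) / 2 by exact: Fle.
    have : 0 <= (2 ^+ n)^-1 :> R by rewrite invr_ge0 exprn_ge0.
    rewrite (rnormBC (x n)) exprS invfM; lra.
  rewrite {1 2}gF /F -scalerDl -rmorphD /= (_ : 2^-1 + 2^-1 = 1) ?scale1r//.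
  lra.
Qed.

End Cstar.

(** * Powers of unitaries *)

Section UnitaryPowers.
Variables (R : realType) (A : cstarAlgType R).
Implicit Types g k v z : A.

(** With [c = 1 - g], the last hypothesis reads [c^2 + v^2 = 1], so [1 + k = c + i v] satisfies
    [(c - i v) (c + i v) = 1], as [c] and [v] commute. The conclusion is this identity with the unit
    cancelled. *)
Lemma cosine_unitary v g (k := 'i%C *: v - g) :
  star v = v -> star g = g -> v ** g = g ** v -> g + g = v ** v + g ** g ->
  star k + k + star k ** k = 0.
Proof.
move=> vv gg vg gE.
have -> : star k = - ('i%C *: v) - g by rewrite starB star_iZ vv gg.
rewrite /k addrACA addNr add0r -opprD gE.
rewrite amulBl !amulBr !amulNl !amulZl !amulZr scalerA vg opprK.
rewrite (_ : 'i%C * 'i%C = -1) ?scaleN1r ?opprK; last first.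
  by apply/eqP; rewrite eq_complex /= !mul0r !mul1r !sub0r !addr0 oppr0 !eqxx.
by rewrite opprB addrACA subrr addr0 addNr.
Qed.

(* [1 + square_shift k = (1 + k)^2]. *)
Definition square_shift k := k + k + k ** k.

Lemma square_shift_contraction k :
  (forall z, rnorm (z + k ** z) <= rnorm z) ->
  forall z, rnorm (z + square_shift k ** z) <= rnorm z.
Proof.
move=> kP z; apply: le_trans (kP z); apply: le_trans (kP _).
by rewrite /square_shift !amulDl amulDr -amulA !addrA.
Qed.

Lemma iter_square_shift_contraction k n :
  (forall z, rnorm (z + k ** z) <= rnorm z) ->
  forall z, rnorm (z + iter n square_shift k ** z) <= rnorm z.
Proof. by move=> kP; elim: n => //= n; exact: square_shift_contraction. Qed.

(** The explicit formulas let bounds on [f a], and its vanishing, pass to [f h1] and [f h2] for a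
    *-homomorphism [f]. *)
Lemma self_adjoint_decomposition (a : A) : exists h1 h2 : A,
  [/\ star h1 = h1, star h2 = h2, a = h1 + 'i%C *: h2,
      h1 = (2^-1)%:C%C *: (a + star a) &
      h2 = (2^-1)%:C%C *: ('i%C *: (star a - a))].
Proof.
exists ((2^-1)%:C%C *: (a + star a)), ((2^-1)%:C%C *: ('i%C *: (star a - a))).
split => //.
- by rewrite star_RZ starD starK addrC.
- by rewrite star_RZ star_iZ starB starK -scalerN opprB.
rewrite !scalerA [_ * 'i%C](_ : _ = - (2^-1)%:C%C).
  rewrite scaleNr -scalerN opprB -scalerDr addrACA subrr addr0 scalerDr -scalerDl.
  by rewrite -rmorphD /= (_ : 2^-1 + 2^-1 = 1) ?scale1r//; lra.
by apply/eqP; rewrite eq_complex /=; apply/andP; split; apply/eqP; ring.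
Qed.

End UnitaryPowers.

(** * Boundedness, bounded lifts and kernels of *-homomorphisms *)

Section StarHom.
Variables (R : realType) (A B : cstarAlgType R) (f : {linear A -> B}).
Hypothesis f_hom : star_hom f.

Let fM a b : f (a ** b) = f a ** f b. Proof. by case: f_hom. Qed.
Let fS a : f (star a) = star (f a). Proof. by case: f_hom. Qed.

Let f_cosine v g : star v = v -> star g = g -> v ** g = g ** v ->
    g + g = v ** v + g ** g ->
  let k := f ('i%C *: v - g) in star k + k + star k ** k = 0.
Proof.
move=> vv gg vg gE /=; rewrite linearB linearZ /=; apply: cosine_unitary.
- by rewrite -fS vv.
- by rewrite -fS gg.
- by rewrite -!fM vg.
- by rewrite -linearD gE linearD !fM.
Qed.

(** For self-adjoint [w] of norm at most 1/2, the unitary [1 + k] over [B] gives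
    [2 |f w| = |k - star k| <= 4]; scaling yields the constant 4 on self-adjoint elements. Applied
    to [star a ** a], this becomes 2 on all of [A] by the C*-identity. *)
Lemma star_hom_bounded (a : A) : rnorm (f a) <= 2 * rnorm a.
Proof.
have sa (v : A) : star v = v -> rnorm (f v) <= 4 * rnorm v.
  move=> vv; have := rnorm_ge0 v; rewrite le_eqVlt => /predU1P[/esym v0|v0].
    have -> : v = 0 by apply: rnorm_le0; rewrite v0.
    by rewrite linear0 !rnorm0 mulr0.
  pose c := (2 * rnorm v)^-1; have c0 : 0 < c by rewrite invr_gt0 mulr_gt0.
  pose w := c%:C%C *: v; have ww : star w = w by rewrite star_RZ vv.
  have w2 : rnorm w <= 1 / 2.
    rewrite rnormZ gtr0_norm// /c [leLHS](_ : _ = 1 / 2)//; field.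
    by rewrite gt_eqF.
  have [g [gg wg gE _]] := exists_cosine ww w2.
  have k0 := f_cosine ww gg wg gE; set k := f _ in k0.
  have k2 : rnorm k <= 2.
    by apply: rnorm_quasi_isometry => z; rewrite rnorm_unitary.
  have : k - star k = 'i%C *: (2%:C%C *: f w).
    rewrite -fS starB star_iZ ww gg -linearB opprD !opprK addrACA addNr addr0.
    rewrite -scalerDr linearZ linearD /=; congr (_ *: _).
    by rewrite (rmorph_nat (real_complex R) 2) scaler_nat.
  move/(congr1 (@rnorm _ _)); rewrite rnormiZ rnormZ ger0_norm// => kE.
  have := rnormB k (star k); rewrite rnorm_star kE linearZ rnormZ gtr0_norm//.
  move=> fv; have : c * rnorm (f v) <= 2 by lra.
  rewrite mulrC ler_pdivrMr ?mulr_gt0//; lra.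
rewrite -(@ler_pXn2r _ 2)// ?nnegrE ?mulr_ge0 ?rnorm_ge0//.
rewrite -rnorm_star_amul -fS -fM exprMn -rnorm_star_amul.
apply: le_trans (sa _ _) _; first by rewrite starM starK.
by rewrite ler_wpM2r ?rnorm_ge0//; lra.
Qed.

(** The lift is [k N] divided by [i t], where [k N] has norm at most 2 and [f (k N)] is close to
    [i t (f h)]. *)
Let approximate_lift_sa (h : A) : star h = h ->
  exists k, rnorm k <= 16 * rnorm (f h) /\ rnorm (f (h - k)) <= rnorm (f h) / 4.
Proof.
move=> hh; have := rnorm_ge0 (f h); rewrite le_eqVlt => /predU1P[/esym h0|h0].
  by exists 0; rewrite subr0 h0 rnorm0 mulr0 mul0r.
(* This [t] makes [2 ^+ N * rnorm (f v) = 1 / 8] whatever [N] is; the error [2 * (1 / 8) ^+ 2],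
   divided by [t], is then a quarter of [rnorm (f h)]. *)
pose t := (8 * rnorm (f h))^-1; have t0 : 0 < t by rewrite invr_gt0 mulr_gt0.
(* [N] only has to make [v] small enough for [exists_cosine]; the final bounds do not depend on
   it. *)
have [N NP] : exists N, t * rnorm h / 2 ^+ N < 1 / 2.
  apply: contrapT => /forallNP nP; have : (1 / 2 : R) <= 0.
    apply: (@le0_geometric _ _ (t * rnorm h)) => n; rewrite leNgt.
    exact/negP/nP.
  by rewrite leNgt divr_gt0.
pose c := t / 2 ^+ N; have c0 : 0 < c by rewrite divr_gt0 ?exprn_gt0.
pose v := c%:C%C *: h; have vv : star v = v by rewrite star_RZ hh.
have v2 : rnorm v <= 1 / 2.
  by rewrite rnormZ gtr0_norm// /c mulrAC ltW.
have [g [gg vg gE g4]] := exists_cosine vv v2.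
pose k n := iter n (@square_shift _ A) ('i%C *: v - g).
have kP n z : rnorm (z + k n ** z) <= rnorm z.
  by apply: iter_square_shift_contraction => y;
    rewrite rnorm_unitary// cosine_unitary.
have fkP n z : rnorm (z + f (k n) ** z) <= rnorm z.
  have -> : f (k n) = iter n (@square_shift _ B) (f ('i%C *: v - g)).
    by elim: n => //= n <-; rewrite {1}/square_shift !linearD fM.
  apply: iter_square_shift_contraction => y.
  by rewrite rnorm_unitary//; exact: f_cosine.
have k2 n : rnorm (k n) <= 2 by exact: rnorm_quasi_isometry.
set x := rnorm (f v).
have x0 : 0 <= x by exact: rnorm_ge0.
have xE : x * 2 ^+ N = 1 / 8.
  rewrite /x linearZ rnormZ gtr0_norm// /c /t; field.
  by rewrite expf_neq0//=; exact: lt0r_neq0.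
have x1 : x <= 1.
  apply: le_trans (_ : x * 2 ^+ N <= 1); last by rewrite xE; lra.
  by rewrite ler_peMr// exprn_ege1//; lra.
(* Since [2 f g = (f v)^2 + (f g)^2] and [rnorm (f g) <= 1 / 2], the term [(f g)^2] is absorbed on
   the left. *)
have fg : rnorm (f g) <= x ^+ 2.
  have := star_hom_bounded g; have := rnorm_amul (f v) (f v).
  have := rnorm_amul (f g) (f g); have := rnormD (f v ** f v) (f g ** f g).
  rewrite -!fM -linearD -gE -mulr2n -scaler_nat linearZ /=.
  rewrite -(rmorph_nat (real_complex R)) rnormZ ger0_norm// -/x.
  have := rnorm_ge0 (f g); nra.
(* The contraction bounds [f (k n) + f (k n) ** f (k n)] by [f (k n)] in norm, so each squaring at
   most doubles the norm. *)
have fk n : rnorm (f (k n)) <= 2 * x * 2 ^+ n.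
  elim: n => [|n IH].
    rewrite expr0 mulr1 /k /= linearB linearZ /=.
    have := rnormB ('i%C *: f v) (f g); rewrite rnormiZ -/x; nra.
  rewrite /= /square_shift -addrA linearD [X in _ + X]linearD fM.
  apply: le_trans (rnormD _ _) _; have := fkP n (f (k n)).
  rewrite exprS; lra.
(* Squaring doubles the error and adds [f (k n) ** f (k n)]; with [y = x * 2 ^+ n] the sum is at
   most [4 y^2 + 4 y^2 = 2 (2 y)^2]. *)
have ek n :
    rnorm (f (k n) - (2 ^+ n)%:C%C *: ('i%C *: f v)) <= 2 * (x * 2 ^+ n) ^+ 2.
  elim: n => [|n IH].
    rewrite expr0 rmorph1 scale1r mulr1 /k /= linearB linearZ /= addrAC subrr.
    rewrite add0r rnormN; apply: le_trans fg _.
    by rewrite ler_peMl ?sqr_ge0//; lra.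
  have -> : f (k n.+1) - (2 ^+ n.+1)%:C%C *: ('i%C *: f v) =
      2%:C%C *: (f (k n) - (2 ^+ n)%:C%C *: ('i%C *: f v)) + f (k n) ** f (k n).
    have -> : f (k n.+1) = 2%:C%C *: f (k n) + f (k n) ** f (k n).
      by rewrite [k n.+1]/(k n + k n + k n ** k n) !linearD fM
        (rmorph_nat (real_complex R) 2) scaler_nat.
    by rewrite exprS rmorphM -scalerA scalerBr addrAC.
  apply: le_trans (rnormD _ _) _; rewrite rnormZ ger0_norm//.
  have := rnorm_amul (f (k n)) (f (k n)); have := fk n; have := rnorm_ge0 (f (k n)).
  rewrite !exprS; set e := 2 ^+ n in IH *; move=> p1 p2 p3.
  have : rnorm (f (k n)) * rnorm (f (k n)) <= (2 * x * e) * (2 * x * e).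
    by rewrite ler_pM.
  lra.
have tV : t^-1 = 8 * rnorm (f h) by rewrite /t invrK.
exists ((t^-1)%:C%C *: (- ('i%C *: k N))); split.
  rewrite rnormZ rnormN rnormiZ tV ger0_norm ?mulr_ge0 ?rnorm_ge0//.
  have := k2 N; nra.
have -> : f (h - (t^-1)%:C%C *: - ('i%C *: k N)) =
    (t^-1)%:C%C *: ('i%C *: (f (k N) - (2 ^+ N)%:C%C *: ('i%C *: f v))).
  have fh : f h = - ((t^-1)%:C%C *: ('i%C *: ((2 ^+ N)%:C%C *: ('i%C *: f v)))).
    have -> : f v = c%:C%C *: f h by rewrite linearZ.
    rewrite !scalerA -scaleNr -[LHS]scale1r; congr (_ *: _).
    have t1 : t^-1 * 2 ^+ N * c = 1.
      by rewrite /c; field; rewrite (gt_eqF t0) /= expf_neq0.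
    have i1 : 'i%C * 'i%C = -1 :> R[i].
      by apply/eqP; rewrite eq_complex /= !mul0r !mul1r !sub0r !addr0 oppr0 !eqxx.
    transitivity ((t^-1 * 2 ^+ N * c)%:C%C : R[i]); first by rewrite t1.
    move: (c) => d; rewrite !rmorphM /=.
    move: (t^-1)%:C%C (2 ^+ N)%:C%C d%:C%C => p q r.
    transitivity (- ('i%C * 'i%C) * (p * q * r)); last by ring.
    by rewrite i1 opprK mul1r.
  by rewrite linearB linearZ linearN linearZ /= !scalerN opprK !scalerBr fh
    addrC [f (_ *: k N)]linearZ.
rewrite rnormZ rnormiZ tV ger0_norm ?mulr_ge0 ?rnorm_ge0//.
have := ek N; rewrite xE; nra.
Qed.

(** Real and imaginary parts are treated separately, which doubles both constants. *)
Let approximate_lift (a : A) :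
  exists k, rnorm k <= 32 * rnorm (f a) /\ rnorm (f (a - k)) <= rnorm (f a) / 2.
Proof.
have [h1 [h2 [hh1 hh2 aE h1E h2E]]] := self_adjoint_decomposition a.
have h1le : rnorm (f h1) <= rnorm (f a).
  rewrite h1E linearZ rnormZ ger0_norm// linearD fS.
  have := rnormD (f a) (star (f a)); rewrite rnorm_star; lra.
have h2le : rnorm (f h2) <= rnorm (f a).
  rewrite h2E linearZ linearZ rnormZ rnormiZ ger0_norm// linearB fS.
  have := rnormB (star (f a)) (f a); rewrite rnorm_star; lra.
have [k1 [k1P k1E]] := approximate_lift_sa hh1.
have [k2 [k2P k2E]] := approximate_lift_sa hh2.
exists (k1 + 'i%C *: k2); split.
  have := rnormD k1 ('i%C *: k2); rewrite rnormiZ; lra.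
rewrite {1}aE opprD addrACA -scalerBr linearD linearZ /=.
have := rnormD (f (h1 - k1)) ('i%C *: f (h2 - k2)); rewrite rnormiZ; lra.
Qed.

(* A quantitative form of the closedness of the range of a *-homomorphism. *)
Lemma star_hom_lift (a : A) :
  exists2 a', f a' = f a & rnorm a' <= 64 * rnorm (f a).
Proof.
have [F FP] := choice approximate_lift.
(* [r n] is what remains of [a] after [n] corrections; the partial sums [a - r n] converge to the
   lift. *)
pose r n := iter n (fun b => b - F b) a.
have rP n : rnorm (f (r n)) <= rnorm (f a) / 2 ^+ n.
  elim: n => [|n IH]; first by rewrite expr0 divr1.
  apply: le_trans (FP (r n)).2 _; rewrite exprS invfM mulrCA mulrC.
  by rewrite ler_wpM2l// invr_ge0.
have sP n : rnorm ((a - r n.+1) - (a - r n)) <= 32 * rnorm (f a) / 2 ^+ n.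
  rewrite [r n.+1]/(r n - F (r n)) !opprB (addrA a) subrKA addrAC subrr add0r.
  by have := (FP (r n)).1; have := rP n; lra.
have [l lP] := @geometric_cvg _ _ (fun n => a - r n) _ sP.
exists l; last by have := lP 0%N; rewrite subrr subr0 expr0; lra.
apply/eqP; rewrite -subr_eq0; apply/eqP/rnorm_le0.
(* [129 = 2 * 64 + 1]: the bound 2 on [f] times the distance from [l] to [a - r n], plus the norm of
   [f (r n)]. *)
apply: (@le0_geometric _ _ (129 * rnorm (f a))) => n.
have -> : f l - f a = f (l - (a - r n)) - f (r n).
  by rewrite -!linearB /= opprB addrA addrAC addrK.
apply: le_trans (rnormB _ _) _.
have := rP n; have := lP n; have := star_hom_bounded (l - (a - r n)); lra.
Qed.

(** For small self-adjoint [v] in the kernel, [T] doubles at each squaring of [1 + k] while [k n]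
    stays bounded, so [T] kills [i v - g]; it also kills [g], half a sum of two products, hence
    [v]. *)
Lemma vanish_on_kernel (V : normedModType R[i]) (T : {linear A -> V}) :
    continuous T ->
    (forall a b, f a = 0 -> f b = 0 -> T (a ** b) = 0) ->
  forall a, f a = 0 -> T a = 0.
Proof.
move=> /continuous_rbounded[M M0 TM] Tprod.
have sa_small (v : A) : star v = v -> rnorm v <= 1 / 2 -> f v = 0 -> T v = 0.
  move=> vv v2 fv; have [g [gg vg gE g4]] := exists_cosine vv v2.
  (* Here [2 f g = (f g)^2] with [rnorm (f g) <= 1 / 2], which forces [f g = 0]. *)
  have fg : f g = 0.
    apply: rnorm_le0; have := rnorm_amul (f g) (f g).
    have -> : f g ** f g = 2%:C%C *: f g.
      rewrite -[2]/(1 + 1) rmorphD scalerDl scale1r -linearD gE linearD !fM.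
      by rewrite fv amul0l add0r.
    rewrite rnormZ ger0_norm//; have := star_hom_bounded g.
    have := rnorm_ge0 (f g); nra.
  pose k n := iter n (@square_shift _ A) ('i%C *: v - g).
  have fk n : f (k n) = 0.
    elim: n => [|n IH]; first by rewrite linearB linearZ /= fv fg scaler0 subrr.
    by rewrite /= /square_shift !linearD fM IH amul0l !addr0.
  have k2 n : rnorm (k n) <= 2.
    apply: rnorm_quasi_isometry; apply: iter_square_shift_contraction => z.
    by rewrite rnorm_unitary// cosine_unitary.
  have Tk n : T (k n) = (2 ^+ n)%:C%C *: T (k 0%N).
    elim: n => [|n IH]; first by rewrite expr0 scale1r.
    have -> : T (k n.+1) = T (k n) + T (k n).
      by rewrite [k n.+1]/(k n + k n + k n ** k n) !linearD /= Tprod// addr0.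
    by rewrite IH -scalerDl -rmorphD /= exprS -mulr2n mulr_natl.
  have Tk0 : T (k 0%N) = 0.
    apply: rnorm_le0; apply: (@le0_geometric _ _ (M * 2)) => n.
    rewrite ler_pdivlMr ?exprn_gt0// mulrC.
    apply: (@le_trans _ _ (rnorm (T (k n)))).
      by rewrite (Tk n) rnormZ ger0_norm ?exprn_ge0.
    by apply: le_trans (TM _) _; rewrite ler_wpM2l.
  have Tg : T g = 0.
    have : T g + T g = 0 by rewrite -linearD gE linearD !Tprod// addr0.
    by rewrite -mulr2n -scaler_nat => /eqP; rewrite scaler_eq0 pnatr_eq0 /= => /eqP.
  have := Tk0; rewrite /k /= linearB linearZ /= Tg subr0 => /eqP.
  by rewrite scaler_eq0 eq_complex /= oner_eq0 andbF /= => /eqP.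
have sa (v : A) : star v = v -> f v = 0 -> T v = 0.
  move=> vv fv; have := rnorm_ge0 v; rewrite le_eqVlt => /predU1P[/esym v0|v0].
    have -> : v = 0 by apply: rnorm_le0; rewrite v0.
    by rewrite linear0.
  pose c := (2 * rnorm v)^-1; have c0 : 0 < c by rewrite invr_gt0 mulr_gt0.
  have : T (c%:C%C *: v) = 0.
    apply: sa_small.
    - by rewrite star_RZ vv.
    - rewrite rnormZ gtr0_norm// /c [leLHS](_ : _ = 1 / 2)//; field.
      by rewrite gt_eqF.
    - by rewrite linearZ /= fv scaler0.
  rewrite linearZ /= => /eqP; rewrite scaler_eq0 eq_complex /= (gt_eqF c0) /=.
  by move/eqP.
move=> a fa; have [h1 [h2 [hh1 hh2 aE h1E h2E]]] := self_adjoint_decomposition a.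
have fsa : f (star a) = 0 by rewrite fS fa star0.
have fh1 : f h1 = 0 by rewrite h1E linearZ linearD /= fa fsa addr0 scaler0.
have fh2 : f h2 = 0.
  by rewrite h2E linearZ linearZ linearB /= fa fsa subr0 !scaler0.
by rewrite aE linearD linearZ /= !sa// scaler0 addr0.
Qed.

End StarHom.

(** * Corestriction of a linear map to its range *)

Section Corange.
Variables (K : numFieldType) (A B : normedAlgType K) (f : {linear A -> B}).
Variable fM : range_subalg f.

Lemma corange_linear : linear (corange fM).
Proof. by move=> k a b; apply: val_inj; rewrite /= linearP. Qed.

HB.instance Definition _ := GRing.isLinear.Build K A (range_alg fM) *:%R
  (corange fM) corange_linear.

Lemma corange_surj (x : range_alg fM) : exists a, x = corange fM a.
Proof.
by have /asboolP[a ax] := range_valP x; exists a; apply: val_inj; rewrite /= ax.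
Qed.

Lemma corange_eq0 a : (corange fM a = 0) <-> (f a = 0).
Proof. by split=> [/(congr1 val)|fa]; [|apply: val_inj]. Qed.

End Corange.

(** * Factoring through the range of a *-homomorphism *)

Section RangeStarHom.
Variables (R : realType) (A B : cstarAlgType R) (f : {linear A -> B}).
Hypothesis f_hom : star_hom f.
Local Notation fM := (star_hom_range_subalg f_hom).

Lemma corangeM a b : corange fM (a ** b) = corange fM a ** corange fM b.
Proof. by apply: val_inj; rewrite /=; case: f_hom. Qed.

Lemma corange_continuous : continuous (corange fM).
Proof.
apply: (@rbounded_continuous _ _ _ (corange fM) 2) => a.
exact: (star_hom_bounded f_hom).
Qed.

(** A chosen preimage [s x] may be large, but [T] takes the same value at the preimage from
    [star_hom_lift], whose norm is at most [64 |x|]; hence continuity. *)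
Lemma factor_through_range (V : normedModType R[i]) (T : {linear A -> V}) :
    continuous T -> (forall a, f a = 0 -> T a = 0) ->
  exists2 F : {linear range_alg fM -> V},
    continuous F & forall a, F (corange fM a) = T a.
Proof.
move=> /continuous_rbounded[M M0 TM] T0.
have [s sP] := choice (@corange_surj _ _ _ _ fM).
have Ts a : T (s (corange fM a)) = T a.
  apply/eqP; rewrite -subr_eq0 -linearB; apply/eqP/T0; rewrite linearB /=.
  by have := congr1 val (sP (corange fM a)); rewrite /= => <-; rewrite subrr.
have Ts_linear : linear (T \o s).
  move=> k x y; rewrite [in LHS](sP x) [in LHS](sP y) /= -linearP Ts.
  by rewrite linearP.
pose F : {linear range_alg fM -> V} :=
  HB.pack (T \o s) (GRing.isLinear.Build _ _ _ _ (T \o s) Ts_linear).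
exists F => // ; apply: (@rbounded_continuous _ _ _ F (M * 64)) => x.
have [a' fa' a'le] := star_hom_lift f_hom (s x).
have -> : F x = T a'.
  rewrite [LHS]/(T (s x)); apply/eqP.
  by rewrite -subr_eq0 -linearB T0// linearB fa' /= subrr.
apply: le_trans (TM _) _; rewrite -mulrA ler_wpM2l//; apply: le_trans a'le _.
by rewrite {2}(sP x).
Qed.

End RangeStarHom.

(** * Banach bimodules: bounds, restriction, annihilators *)

Section Bimodules.
Variable (R : realType).
Local Notation C := R[i].

Section BimoduleLaws.
Variables (B1 B2 : normedAlgType C) (X : completeNormedModType C).
Variable M : banach_bimodule B1 B2 X.

Lemma lactDr a x y : lact M a (x + y) = lact M a x + lact M a y.
Proof. by have := lact_linearr M a 1 x y; rewrite !scale1r. Qed.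

Lemma ractDl x y b : ract M (x + y) b = ract M x b + ract M y b.
Proof. by have := ract_linearl M b 1 x y; rewrite !scale1r. Qed.

Lemma lact0r a : lact M a 0 = 0.
Proof. by apply: (@addrI _ (lact M a 0)); rewrite -lactDr !addr0. Qed.

Lemma ract0l b : ract M 0 b = 0.
Proof. by apply: (@addrI _ (ract M 0 b)); rewrite -ractDl !addr0. Qed.

Lemma lact0l x : lact M 0 x = 0.
Proof.
by have := lact_linearl M x (-1) 0 0; rewrite scaler0 addr0 scaleN1r addNr.
Qed.

Lemma ract0r x : ract M x 0 = 0.
Proof.
by have := ract_linearr M x (-1) 0 0; rewrite scaler0 addr0 scaleN1r addNr.
Qed.

Lemma lactNr a x : lact M a (- x) = - lact M a x.
Proof. by apply/eqP; rewrite -addr_eq0 -lactDr addNr lact0r. Qed.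

Lemma ractNl x b : ract M (- x) b = - ract M x b.
Proof. by apply/eqP; rewrite -addr_eq0 -ractDl addNr ract0l. Qed.

Lemma rlact_bounded : exists2 c : R, 0 <= c &
  forall a x, rnorm (lact M a x) <= c * rnorm a * rnorm x.
Proof.
have [c cP] := lact_bounded M; exists (complex.Re `|c|).
  exact: (rnorm_ge0 (c : C^o)).
move=> a x; rewrite -lecR !rmorphM /= -(ge0_complexE (normr_ge0 c)) -!rnormE -mulrA.
by apply: ler_normM; rewrite ?mulr_ge0// mulrA.
Qed.

Lemma rract_bounded : exists2 c : R, 0 <= c &
  forall x b, rnorm (ract M x b) <= c * rnorm x * rnorm b.
Proof.
have [c cP] := ract_bounded M; exists (complex.Re `|c|).
  exact: (rnorm_ge0 (c : C^o)).
move=> x b; rewrite -lecR !rmorphM /= -(ge0_complexE (normr_ge0 c)) -!rnormE -mulrA.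
by apply: ler_normM; rewrite ?mulr_ge0// mulrA.
Qed.

End BimoduleLaws.

Section Restriction.
Variables (B1 B2 B1' B2' : normedAlgType C) (X : completeNormedModType C).
Variables (M : banach_bimodule B1 B2 X).
Variables (f1 : {linear B1' -> B1}) (f2 : {linear B2' -> B2}).
Hypotheses (f1M : forall a b, f1 (a ** b) = f1 a ** f1 b) (f1c : continuous f1).
Hypotheses (f2M : forall a b, f2 (a ** b) = f2 a ** f2 b) (f2c : continuous f2).

(** Below, one of the maps is the identity and the other a homomorphism between the two ranges. *)
Program Definition restrict_bimodule : banach_bimodule B1' B2' X :=
  @BanachBimodule _ _ _ _ (fun a x => lact M (f1 a) x)
    (fun x b => ract M x (f2 b)) _ _ _ _ _ _ _ _ _.
Next Obligation. by move=> x k a b /=; rewrite linearP lact_linearl. Qed.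
Next Obligation. by move=> a k x y /=; rewrite lact_linearr. Qed.
Next Obligation. by move=> b k x y /=; rewrite ract_linearl. Qed.
Next Obligation. by move=> x k a b /=; rewrite linearP ract_linearr. Qed.
Next Obligation. by move=> a b x /=; rewrite f1M lactA. Qed.
Next Obligation. by move=> x a b /=; rewrite f2M ractA. Qed.
Next Obligation. by move=> a x b /=; rewrite lractA. Qed.
Next Obligation.
have [c c0 cP] := rlact_bounded M; have [d d0 dP] := continuous_rbounded f1c.
exists (c * d)%:C%C => a x; rewrite !rnormE -!rmorphM lecR /=.
apply: le_trans (cP _ _) _; rewrite ler_wpM2r ?rnorm_ge0// -mulrA.
by rewrite ler_wpM2l.
Qed.
Next Obligation.
have [c c0 cP] := rract_bounded M; have [d d0 dP] := continuous_rbounded f2c.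
exists (c * d)%:C%C => x b; rewrite !rnormE -!rmorphM lecR /=.
apply: le_trans (cP _ _) _; rewrite mulrAC [leRHS]mulrAC.
by rewrite ler_wpM2r ?rnorm_ge0// -!mulrA ler_wpM2l.
Qed.

End Restriction.

(** * The submodule annihilated by the left action *)

Section LeftAnnihilator.
Variables (B1 B2 : normedAlgType C) (X : completeNormedModType C).
Variable M : banach_bimodule B1 B2 X.

Definition ann_pred : {pred X} := [pred x | `[< forall a, lact M a x = 0 >]].

Record left_ann := LeftAnn { ann_val : X; ann_valP : ann_val \in ann_pred }.

HB.instance Definition _ := [isSub for ann_val].
HB.instance Definition _ := [Choice of left_ann by <:].

Let ann_submod_closed : submod_closed ann_pred.
Proof.
split; first by apply/asboolP => a; exact: lact0r.
move=> k x y /asboolP x0 /asboolP y0; apply/asboolP => a.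
by rewrite lact_linearr x0 y0 scaler0 addr0.
Qed.

HB.instance Definition _ := GRing.SubChoice_isSubLmodule.Build
  C X ann_pred left_ann ann_submod_closed.

Let ann_norm (x : left_ann) : C := `|val x|.

Let ler_ann_normD x y : ann_norm (x + y) <= ann_norm x + ann_norm y.
Proof. by rewrite /ann_norm linearD ler_normD. Qed.

Let ann_normZ k x : ann_norm (k *: x) = `|k| * ann_norm x.
Proof. by rewrite /ann_norm linearZ/= normrZ. Qed.

Let ann_norm0_eq0 x : ann_norm x = 0 -> x = 0.
Proof. by move=> /eqP; rewrite normr_eq0 => /eqP x0; apply: val_inj. Qed.

HB.instance Definition _ := @Lmodule_isNormed.Build C left_ann
  ann_norm ler_ann_normD ann_normZ ann_norm0_eq0.

Lemma ann_val_linear : linear ann_val.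
Proof. by []. Qed.

(** The annihilator is closed: [a l = a (l - x)] for [x] in it, which is small when [x] is near
    [l]. *)
Lemma ann_complete (F : set_system left_ann) :
  ProperFilter F -> cauchy F -> cvg F.
Proof.
move=> FF /cauchy_ballP Fc.
have /cvg_ex[l Fl] : cvg (ann_val @ F).
  apply/cauchy_cvgP/cauchy_ballP => e e0.
  have [[P Q]/= [FP FQ] PQ] := Fc _ e0.
  exists (ann_val @` P, ann_val @` Q).
    by split => /=; [apply: filterS FP | apply: filterS FQ] => x Px; exists x.
  move=> [_ _] [/= [x Px <-] [y Qy <-]].
  by have := PQ (x, y) (conj Px Qy); rewrite -!ball_normE.
have l0 : l \in ann_pred.
  apply/asboolP => a; have [c c0 cP] := rlact_bounded M.
  apply: rnorm_le0; apply/ler_addgt0Pr => e e0; rewrite add0r.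
  have d0 : 0 < c * rnorm a + 1 by rewrite ltr_wpDl// mulr_ge0// rnorm_ge0.
  have ed0 : 0 < (e / (c * rnorm a + 1))%:C%C :> C by rewrite ltcR divr_gt0.
  move/cvgrPdist_lt/(_ _ ed0): Fl => /filter_ex[x].
  rewrite rnormE ltcR ltr_pdivlMr// => lx.
  have /asboolP x0 := ann_valP x.
  rewrite -(subrK (ann_val x) l) lactDr x0 addr0; apply: le_trans (cP _ _) _.
  apply: le_trans (ltW lx); rewrite mulrC ler_wpM2l ?rnorm_ge0//; lra.
apply/cvg_ex; exists (LeftAnn l0); apply/cvgrPdist_lt => e e0.
by move/cvgrPdist_lt/(_ _ e0): Fl.
Qed.

HB.instance Definition _ := Uniform_isComplete.Build left_ann ann_complete.

Fact ann_ractP (x : left_ann) (b : B2) : ract M (ann_val x) b \in ann_pred.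
Proof.
have /asboolP x0 := ann_valP x; apply/asboolP => a.
by rewrite -lractA x0 ract0l.
Qed.

Let ann_ract x b := LeftAnn (ann_ractP x b).

(* Any algebra [B0] may act on the left, by zero. *)
Program Definition ann_bimodule (B0 : normedAlgType C) :
    banach_bimodule B0 B2 left_ann :=
  @BanachBimodule _ _ _ _ (fun _ _ => 0) ann_ract _ _ _ _ _ _ _ _ _.
Next Obligation. by move=> B0 x k a b; rewrite scaler0 addr0. Qed.
Next Obligation. by move=> B0 a k x y; rewrite scaler0 addr0. Qed.
Next Obligation.
by move=> B0 b k x y; apply: val_inj; rewrite /= ract_linearl.
Qed.
Next Obligation.
by move=> B0 x k a b; apply: val_inj; rewrite /= ract_linearr.
Qed.
Next Obligation. by []. Qed.
Next Obligation. by move=> B0 x a b; apply: val_inj; rewrite /= ractA. Qed.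
Next Obligation. by move=> B0 a x b; apply: val_inj; rewrite /= ract0l. Qed.
Next Obligation. by move=> B0; exists 0 => a x; rewrite normr0 !mul0r. Qed.
Next Obligation.
by move=> B0; have [c cP] := ract_bounded M; exists c => x b; exact: cP.
Qed.

End LeftAnnihilator.

End Bimodules.

(** * Derivations of the form [b |-> x b + b x] *)

Section SumInner.
Variables (R : realType) (B : normedAlgType R[i]) (X : completeNormedModType R[i]).
Variables (M : banach_bimodule B B X) (D : {linear B -> X}) (x : X).
Hypothesis DE : forall b, D b = ract M x b + lact M b x.

(** Expanding [D (a b)] by the formula and by the derivation rule gives results that differ by
    [2 a x b]. *)
Lemma sum_inner_annihilates :
  is_derivation M D -> forall a b, lact M a (ract M x b) = 0.
Proof.
move=> Dd a b; have := Dd a b.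
rewrite !DE ractA lactA ractDl lactDr lractA -addrA => /addrI.
rewrite addrA -[in LHS](add0r (lact M a (lact M b x))) => /addIr/esym/eqP.
by rewrite -mulr2n -scaler_nat scaler_eq0 pnatr_eq0 => /eqP.
Qed.

(* [D b = 2 w b - (x b - b x)]. *)
Lemma sum_inner_is_inner (w : X) :
    (forall b, ract M w b = ract M x b) -> (forall b, lact M b w = 0) ->
  is_inner M D.
Proof.
move=> wx w0; exists (w + w - x) => b.
rewrite DE ractDl ractDl ractNl lactDr lactDr lactNr w0 !wx !add0r opprK.
by rewrite addrK.
Qed.

End SumInner.

(** * The map [b |-> x b] into the annihilator *)

Section AnnihilatorOrbit.
Variables (R : realType) (B : normedAlgType R[i]) (X : completeNormedModType R[i]).
Variables (M : banach_bimodule B B X) (x : X).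
Hypothesis x0 : forall a b, lact M a (ract M x b) = 0.

Fact ann_orbitP b : ract M x b \in ann_pred M.
Proof. by apply/asboolP => a; exact: x0. Qed.

Definition ann_orbit b : left_ann M := LeftAnn (ann_orbitP b).

Fact ann_orbit_linear : linear ann_orbit.
Proof. by move=> k a b; apply: val_inj; rewrite /= ract_linearr. Qed.

HB.instance Definition _ := GRing.isLinear.Build R[i] B (left_ann M) *:%R
  ann_orbit ann_orbit_linear.

Lemma ann_orbit_continuous : continuous ann_orbit.
Proof.
have [c c0 cP] := rract_bounded M.
apply: (@rbounded_continuous _ _ _ ann_orbit (c * rnorm x)) => b; exact: cP.
Qed.

End AnnihilatorOrbit.

(** * The canonical embedding into the bidual *)

Section Evaluation.
Variables (R : realType).

Lemma dual_fun_le (V : normedModType R[i]) (f : dual_space V) v :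
  `|f v| <= `|f| * `|v|.
Proof. exact: le_opnorm. Qed.

Variable V : completeNormedModType R[i].

Fact bidual_subproof (v : V) :
  (fun f : dual_space V => f v) \in @dual_pred R (dual_space V).
Proof.
apply: (@dual_pred_bounded _ _ _ `|v|) => [k f g //|f].
by rewrite mulrC dual_fun_le.
Qed.

Definition bidual (v : V) : dual_space (dual_space V) :=
  DualSpace (bidual_subproof v).

Fact bidual_linear : linear bidual.
Proof.
by move=> k u v; apply: dual_space_eq => f; rewrite /= dual_fun_linear.
Qed.

HB.instance Definition _ := GRing.isLinear.Build R[i] V (dual_space (dual_space V))
  *:%R bidual bidual_linear.

Lemma bidual_continuous : continuous bidual.
Proof.
apply: (@rbounded_continuous _ _ _ bidual 1) => v; rewrite mul1r -lecR -!rnormE.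
by apply: dual_norm_le => // f; rewrite mulrC; exact: dual_fun_le.
Qed.

End Evaluation.

(** * Zero actions on dual bimodules *)

Section DualZeroActions.
Variables (R : realType) (B1 B2 : normedAlgType R[i]).
Variables (Y : completeNormedModType R[i]) (M : banach_bimodule B1 B2 Y).

Lemma dual_ract0 f a :
  (forall y, lact M a y = 0) -> ract (dual_bimodule M) f a = 0.
Proof.
by move=> M0; apply: dual_space_eq => y; rewrite /= M0; exact: linear0.
Qed.

Lemma dual_lact0 f b :
  (forall y, ract M y b = 0) -> lact (dual_bimodule M) b f = 0.
Proof.
by move=> M0; apply: dual_space_eq => y; rewrite /= M0; exact: linear0.
Qed.

End DualZeroActions.

(** * From the bidual of the annihilator back to [Y^*] *)

Section AnnihilatorEvaluation.
Variables (R : realType) (B1 B2 : normedAlgType R[i]).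
Variables (Y : completeNormedModType R[i]).
Variable M : banach_bimodule B1 B2 Y.
Local Notation W := (left_ann (dual_bimodule M)).

Fact ann_eval_subproof (y : Y) :
  (fun w : W => ann_val w y) \in @dual_pred R W.
Proof.
have le (w : W) : `|ann_val w y| <= `|y| * `|w|.
  by rewrite mulrC; exact: (dual_fun_le (ann_val w)).
have lin : linear (fun w : W => ann_val w y).
  by move=> k u v; rewrite ann_val_linear.
exact: (@dual_pred_bounded R W _ `|y| lin le).
Qed.

(** The canonical map from [Y] to the dual of [W]; its adjoint carries the bidual of [W] to
    [Y^*]. *)
Definition ann_eval (y : Y) : dual_space W := DualSpace (ann_eval_subproof y).

Lemma ann_eval_le y : `|ann_eval y| <= `|y|.
Proof.
apply: dual_norm_le => // w; rewrite mulrC; exact: (dual_fun_le (ann_val w)).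
Qed.

Fact ann_preimage_subproof (theta : dual_space (dual_space W)) :
  (fun y : Y => theta (ann_eval y)) \in @dual_pred R Y.
Proof.
apply: (@dual_pred_bounded _ _ _ `|theta|) => [k y z|y].
  rewrite -dual_fun_linear; congr (theta _).
  by apply: dual_space_eq => w; rewrite /= dual_fun_linear.
by apply: le_trans (dual_fun_le _ _) _; rewrite ler_wpM2l// ann_eval_le.
Qed.

(* The annihilator [W] is the dual of a quotient of [Y]; this projection of its
   bidual onto [W] avoids constructing that quotient. *)
Definition ann_of_bidual (theta : dual_space (dual_space W)) : dual_space Y :=
  DualSpace (ann_preimage_subproof theta).

(** At [y] the left side is [theta] applied to [ann_eval (y b)], which is zero since
    [w (y b) = (b w) y = 0] for [w] in [W]. *)
Lemma lact_ann_of_bidual theta b :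
  lact (dual_bimodule M) b (ann_of_bidual theta) = 0.
Proof.
apply: dual_space_eq => y /=.
rewrite (_ : ann_eval _ = 0) ?linear0//.
apply: dual_space_eq => w /=; have /asboolP/(_ b) := ann_valP w.
by move/(congr1 (fun f : dual_space Y => f y)).
Qed.

End AnnihilatorEvaluation.

(** * From the range of [sigma] to [A] *)

Section SigmaTau.
Variables (R : realType) (A : cstarAlgType R) (sigma tau : {linear A -> A}).
Hypotheses (hsigma : star_hom sigma) (htau : star_hom tau).
Local Notation sM := (star_hom_range_subalg hsigma).
Local Notation tM := (star_hom_range_subalg htau).
Local Notation sA := (range_alg sM).
Local Notation tA := (range_alg tM).

(** [corange tM] kills the kernel of [sigma], so it factors through [sA]; the bounded lifts make the
    factor continuous. *)
Lemma range_hom : (forall a, sigma a = 0 -> tau a = 0) ->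
  exists phi : {linear sA -> tA},
    [/\ continuous phi, forall a b, phi (a ** b) = phi a ** phi b &
        forall a, phi (corange sM a) = corange tM a].
Proof.
move=> st.
have [|phi phic phiE] :=
  factor_through_range hsigma (@corange_continuous _ _ _ _ htau).
  by move=> a /st/(corange_eq0 tM).
have {}phiE a : phi (corange sM a) = corange tM a by exact: phiE.
exists phi; split => // x y.
have [a ->] := corange_surj x; have [b ->] := corange_surj y.
by rewrite -corangeM !phiE corangeM.
Qed.

Section Transfer.
Variables (X : completeNormedModType R[i]).
Variables (N : banach_bimodule tA sA X) (N0 : banach_bimodule sA sA X).
Hypothesis ractE : forall x b, ract N x b = ract N0 x b.
Hypothesis lactE : forall a x, lact N (corange tM a) x = lact N0 (corange sM a) x.

(** [D] kills products of elements of [ker sigma], hence [ker sigma] itself, and so factors through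
    [sA]. The two bimodules are linked by equations only, which also covers the dual of a restricted
    bimodule. *)
Lemma st_inner_of_derivations_inner :
    (forall a, sigma a = 0 -> tau a = 0) ->
    (forall F : {linear sA -> X},
      continuous F -> is_derivation N0 F -> is_inner N0 F) ->
  forall D : {linear A -> X},
    continuous D -> is_st_derivation N D -> is_st_inner N D.
Proof.
move=> st inner D Dc Dd.
have [|F Fc FE] := factor_through_range hsigma Dc.
  apply: (vanish_on_kernel hsigma Dc) => a b /st/(corange_eq0 tM) a0.
  by move=> /(corange_eq0 sM) b0; rewrite Dd a0 b0 lact0l ract0r addr0.
have [|x xE] := inner F Fc.
  move=> a' b'; have [a ->] := corange_surj a'; have [b ->] := corange_surj b'.
  by rewrite -corangeM !FE Dd ractE lactE.
by exists x; left => a; rewrite -FE xE ractE lactE.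
Qed.

(** The obstacle is innerness with a plus sign; the first hypothesis supplies the [w] that turns it
    into ordinary innerness. *)
Lemma inner_of_st_inner (F : {linear sA -> X}) :
    (forall x, (forall a b, lact N0 a (ract N0 x b) = 0) -> exists w,
      (forall b, ract N0 w b = ract N0 x b) /\ (forall b, lact N0 b w = 0)) ->
    (forall D : {linear A -> X},
      continuous D -> is_st_derivation N D -> is_st_inner N D) ->
  continuous F -> is_derivation N0 F -> is_inner N0 F.
Proof.
move=> ann inner Fc Fd.
have [||x [xE|xE]] := inner (F \o corange sM).
- by move=> a; apply: continuous_comp; [exact: corange_continuous|exact: Fc].
- by move=> a b /=; rewrite corangeM Fd ractE lactE.
- exists x => b; have [a ->] := corange_surj b.
  by have := xE a; rewrite ractE lactE.
have FE b : F b = ract N0 x b + lact N0 b x.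
  by have [a ->] := corange_surj b; have := xE a; rewrite ractE lactE.
have [w [wx w0]] := ann x (sum_inner_annihilates FE Fd).
exact: sum_inner_is_inner FE w wx w0.
Qed.

End Transfer.

Let id_continuous (V : normedModType R[i]) : continuous (idfun : V -> V).
Proof. by move=> x. Qed.

Lemma contractible_st_contractible :
    (forall a, sigma a = 0 -> tau a = 0) ->
  contractible sA -> st_contractible sM tM.
Proof.
move=> st ctr X M; have [phi [phic phiM phiE]] := range_hom st.
pose M0 := restrict_bimodule M phiM phic
  (fun a b : sA => erefl (idfun (a ** b))) (@id_continuous _).
apply: (@st_inner_of_derivations_inner X M M0) => // [a x|].
  by rewrite /= phiE.
exact: ctr.
Qed.

Lemma amenable_st_amenable :
    (forall a, sigma a = 0 -> tau a = 0) ->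
  amenable sA -> st_amenable sM tM.
Proof.
move=> st ame Y M; have [phi [phic phiM phiE]] := range_hom st.
(* The left action on [Y^*] comes from the right action on [Y], so [phi] is put on the right. *)
pose M0 := restrict_bimodule M
  (fun a b : sA => erefl (idfun (a ** b))) (@id_continuous _) phiM phic.
apply: (@st_inner_of_derivations_inner _ (dual_bimodule M)
  (dual_bimodule M0)) => //.
- by move=> f b; apply: dual_space_eq.
- by move=> a f; apply: dual_space_eq => y; rewrite /= phiE.
- exact: ame.
Qed.

End SigmaTau.

(** * From [A] to the range of [sigma] *)

Section Converse.
Variables (R : realType) (A : cstarAlgType R) (sigma tau : {linear A -> A}).
Hypotheses (hsigma : star_hom sigma) (htau : star_hom tau).
Local Notation sM := (star_hom_range_subalg hsigma).
Local Notation tM := (star_hom_range_subalg htau).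
Local Notation sA := (range_alg sM).
Local Notation tA := (range_alg tM).

Section Annihilator.
Variables (X : completeNormedModType R[i]) (N0 : banach_bimodule sA sA X).
Variables (x : X) (x0 : forall a b, lact N0 a (ract N0 x b) = 0).

Lemma ann_orbit_corange_continuous :
  continuous (ann_orbit x0 \o corange sM).
Proof.
move=> a; apply: continuous_comp; first exact: corange_continuous.
exact: ann_orbit_continuous.
Qed.

(** With a zero left action the derivation rule reduces to [x (a b) = (x a) b]. *)
Lemma ann_orbit_st_derivation :
  is_st_derivation (ann_bimodule N0 tA) (ann_orbit x0 \o corange sM).
Proof.
by move=> a b; rewrite addr0; apply: val_inj; rewrite /= corangeM ractA.
Qed.

End Annihilator.

Lemma st_contractible_contractible :
    (forall a, tau a = 0 -> sigma a = 0) ->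
  st_contractible sM tM -> contractible sA.
Proof.
move=> ts ctr X M F; have [psi [psic psiM psiE]] := range_hom htau hsigma ts.
pose N := restrict_bimodule M psiM psic
  (fun a b : sA => erefl (idfun (a ** b))) (fun x => @cvg_id _ _).
apply: (@inner_of_st_inner _ _ _ _ hsigma htau X N M) => //.
- by move=> a x; rewrite /= psiE.
(* The left action on the annihilator is zero, so either sign of innerness gives [x b = w b]. *)
- move=> x x0; have [w wE] := ctr _ _ _ (@ann_orbit_corange_continuous _ _ _ x0)
    (ann_orbit_st_derivation x0).
  exists (val w); split=> b; last by have /asboolP := ann_valP w.
  have [a ->] := corange_surj b.
  by case: wE => /(_ a)/(congr1 val) /=; rewrite ?subr0 ?addr0.
- exact: ctr.
Qed.

Lemma st_amenable_amenable :
    (forall a, tau a = 0 -> sigma a = 0) ->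
  st_amenable sM tM -> amenable sA.
Proof.
move=> ts ame Y M F; have [psi [psic psiM psiE]] := range_hom htau hsigma ts.
pose N := restrict_bimodule M
  (fun a b : sA => erefl (idfun (a ** b))) (fun x => @cvg_id _ _) psiM psic.
apply: (@inner_of_st_inner _ _ _ _ hsigma htau _ (dual_bimodule N)
  (dual_bimodule M)) => //.
- by move=> f b; apply: dual_space_eq.
- by move=> a f; apply: dual_space_eq => y; rewrite /= psiE.
- move=> x x0.
  (* [W] is not presented as a dual bimodule, so the derivation is sent into its bidual, where
     amenability yields [theta]. *)
  pose W := left_ann (dual_bimodule M).
  pose MW : banach_bimodule tA sA W := ann_bimodule (dual_bimodule M) tA.
  pose T : {linear A -> dual_space (dual_space W)} :=
    bidual (V := W) \o (ann_orbit x0 \o corange sM).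
  have Tc : continuous T.
    move=> a; apply: continuous_comp; first exact: ann_orbit_corange_continuous.
    exact: bidual_continuous.
  have Td : is_st_derivation (dual_bimodule (dual_bimodule MW)) T.
    move=> a b; apply: dual_space_eq => f.
    transitivity (f (ann_orbit x0 (corange sM (a ** b)))); first by [].
    by have /= -> := ann_orbit_st_derivation x0 a b; exact: linearD.
  have [theta thetaE] := ame _ (dual_bimodule MW) T Tc Td.
  (* The zero left action on [W] gives a zero right action on its dual, then a zero left action on
     its bidual. *)
  have lact_theta b : lact (dual_bimodule (dual_bimodule MW)) b theta = 0.
    by apply: dual_lact0 => f; exact: dual_ract0.
  exists (ann_of_bidual theta); split=> b; last exact: lact_ann_of_bidual.
  have [a ->] := corange_surj b; apply: dual_space_eq => y.
  have : T a = ract (dual_bimodule (dual_bimodule MW)) theta (corange sM a).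
    by case: thetaE => /(_ a) ->; rewrite lact_theta ?subr0 ?addr0.
  move=> /(congr1 (fun h : dual_space (dual_space W) => h (ann_eval M y))) /= ->.
  (* Both arguments of [theta] are [w |-> w (s y)] with [s = corange sM a]. *)
  by congr (theta _); apply: dual_space_eq.
- exact: ame.
Qed.

End Converse.

Theorem theorem4p3 (R : realType) (A : cstarAlgType R)
    (sigma tau : {linear A -> A})
    (hsigma : star_hom sigma) (htau : star_hom tau)
    (hker : sigma @^-1` [set 0] = tau @^-1` [set 0]) :
  (st_amenable (star_hom_range_subalg hsigma) (star_hom_range_subalg htau) <->
   amenable (range_alg (star_hom_range_subalg hsigma))) /\
  (st_contractible (star_hom_range_subalg hsigma) (star_hom_range_subalg htau) <->
   contractible (range_alg (star_hom_range_subalg hsigma))).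
Proof.
have st a : sigma a = 0 -> tau a = 0.
  by move=> sa; have : (sigma @^-1` [set 0]) a by []; rewrite hker.
have ts a : tau a = 0 -> sigma a = 0.
  by move=> ta; have : (tau @^-1` [set 0]) a by []; rewrite -hker.
split; split.
- exact: st_amenable_amenable ts.
- exact: amenable_st_amenable st.
- exact: st_contractible_contractible ts.
- exact: contractible_st_contractible st.
Qed.
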